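(* Uniformly in the parameter $c\in \mathrm{CompStr}$ and an encoding of a computable set $\Phi$ of quantifier-free first-order $\mathcal{L}_c$-formulas, the set $\mathrm{acl}_{\Phi, c}$ is $\Sigma^0_1$ in $\mathrm{ACL}^c_0$. In particular, $\mathrm{acl}_{\Phi, c}$ is a $\Sigma^0_2$ set.
   Context: Computable structures. Languages are relational and may be many-sorted: $\mathcal{L} = ((X_j)_{j\in J}, (R_i)_{i\in I})$ with sorts $X_j$ and relation symbols $R_i$, where $I,J\in\mathbb{N}\cup\{\mathbb{N}\}$ (a natural number is identified with the set of its predecessors). The type of a tuple of elements or variables is the product of the sorts of its entries, in order; the type of a relation symbol is a finite product of sorts. $\mathcal{L}$ is computable when the function sending $i\in I$ to $(j_0,\dots,j_{m-1})$, where $R_i$ has type $\prod_{k<m}X_{j_k}$, is computable; for each computable language a computable encoding of its first-order formulas is fixed. A computable $\mathcal{L}$-structure $\mathcal{N}$ has a computable underlying set, and $\{(a,j) : a\in (X_j)^{\mathcal{N}}\}$ and $\{(\overline{b},i) : \overline{b}\in (R_i)^{\mathcal{N}}\}$ are computable. Writing $\{e\}$ for the $e$th Turing machine, $c\in\mathbb{N}$ is a code for a structure if $\{c\}(0)$ is a code for a computable language, denoted $\mathcal{L}_c$, and $\{c\}(1)$ is a code for a computable $\mathcal{L}_c$-structure, denoted $\mathcal{M}_c$. $\mathrm{CompStr}$ is the set of all codes for structures. Formulas $\varphi(\overline{x};\overline{y})$ come with a specified partition of their free variables; a set of formulas is a set of formulas with specified partitions. $\mathrm{ACL}^c_0$ is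 the set of pairs $(\varphi(\overline{x};\overline{y}),\overline{a})$ such that $\varphi$ is a quantifier-free first-order $\mathcal{L}_c$-formula, $\overline{a}\in\mathcal{M}_c$ has the same type as $\overline{x}$, and $\{\overline{b}\in\mathcal{M}_c : \mathcal{M}_c\models\varphi(\overline{a};\overline{b})\}$ is finite (possibly empty). For $B\subseteq\mathcal{M}_c$, let $\mathrm{cl}^0(B):=B$; let $\mathrm{cl}^1(B)$ be $B$ together with all $b\in\mathcal{M}_c$ for which there are $\varphi(\overline{x};\overline{y})\in\Phi$ and a tuple $\overline{a}$ from $B$ such that $\{\overline{d} : \mathcal{M}_c\models\varphi(\overline{a};\overline{d})\}$ is finite, and a tuple $\overline{b}\in\mathcal{M}_c$ having $b$ as an entry with $\mathcal{M}_c\models\varphi(\overline{a};\overline{b})$; let $\mathrm{cl}^{m+1}(B):=\mathrm{cl}^1(\mathrm{cl}^m(B))$; and let $\mathrm{acl}_{\Phi,c}(B):=\bigcup_m\mathrm{cl}^m(B)$. Then, as a set, $\mathrm{acl}_{\Phi,c}:=\{(a,A) : A\subseteq\mathcal{M}_c\text{ finite},\ a\in\mathrm{acl}_{\Phi,c}(A)\}$. ''Uniformly in'' the parameters means that the description (index) of the set at the stated level is obtained computably from $c$ and the encoding of $\Phi$. *)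

(* Defs.v *)
From mathcomp Require Import all_boot.
From mathcomp Require Import boolp classical_sets functions cardinality.

Set Implicit Arguments.
Unset Strict Implicit.
Unset Printing Implicit Defensive.

Local Open Scope classical_set_scope.

(* Cantor's bijection from nat * nat to nat. *)
Definition cpair (a b : nat) : nat := ((a + b) * (a + b).+1)./2 + a.

(* A bijection from seq nat to nat. *)
Fixpoint code_seq (s : seq nat) : nat :=
  if s is a :: s' then (cpair a (code_seq s')).+1 else 0.

(* The finite set with canonical index u: i is in it when the i-th binary digit
   of u is 1. Every finite set of naturals has exactly one canonical index. *)
Definition canonical_set (u : nat) : set nat := [set i | odd (u %/ 2 ^ i)].

(* Programs denote partial functions from nat to nat; several arguments are
   passed as one number, through cpair. The identity is Pair Fst Snd. *)
Inductive prog : Type :=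
| Zero | Succ | Fst | Snd | Oracle
| Pair of prog & prog
| Comp of prog & prog
| Prec of prog & prog
| Mu of prog.

(* run X p n m: with oracle X, the program p halts on input n with output m. *)
Fixpoint run (X : set nat) (p : prog) (n m : nat) : Prop :=
  match p with
  | Zero => m = 0
  | Succ => m = n.+1
  | Fst => exists b, n = cpair m b
  | Snd => exists a, n = cpair a m
  | Oracle => (X n /\ m = 1) \/ (~ X n /\ m = 0)
  | Pair f g => exists a b, [/\ run X f n a, run X g n b & m = cpair a b]
  | Comp f g => exists2 k, run X g n k & run X f k m
  (* h (a, 0) = f a and h (a, i + 1) = g (a, (i, h (a, i))) *)
  | Prec f g => exists a k (h : nat -> nat),
      [/\ n = cpair a k, run X f a (h 0),
          forall i, i < k -> run X g (cpair a (cpair i (h i))) (h i.+1)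
        & m = h k]
  (* the least m with f (n, m) = 0, all earlier values being defined *)
  | Mu f => run X f (cpair n m) 0 /\
      forall i, i < m -> exists r, run X f (cpair n i) r.+1
  end.

Fixpoint code_prog (p : prog) : nat :=
  match p with
  | Zero => cpair 0 0
  | Succ => cpair 1 0
  | Fst => cpair 2 0
  | Snd => cpair 3 0
  | Oracle => cpair 4 0
  | Pair f g => cpair 5 (cpair (code_prog f) (code_prog g))
  | Comp f g => cpair 6 (cpair (code_prog f) (code_prog g))
  | Prec f g => cpair 7 (cpair (code_prog f) (code_prog g))
  | Mu f => cpair 8 (code_prog f)
  end.

(* {e}^X(n) = m. Numbers that code no program index the empty function. *)
Definition phi (X : set nat) (e n m : nat) : Prop :=
  exists2 p, code_prog p = e & run X p n m.

Definition decides (X : set nat) (e : nat) (A : set nat) : Prop :=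
  forall n, (A n -> phi X e n 1) /\ (~ A n -> phi X e n 0).

Definition computable2 (f : nat -> nat -> nat) : Prop :=
  exists e, forall a b, phi set0 e (cpair a b) (f a b).

Definition Sigma1_index (X : set nat) (e : nat) (A : set nat) : Prop :=
  exists2 R : set nat, decides X e R &
    forall n, A n <-> exists j, R (cpair n j).

Definition Sigma2_index (X : set nat) (e : nat) (A : set nat) : Prop :=
  exists2 R : set nat, decides X e R &
    forall n, A n <-> exists j, forall k, R (cpair n (cpair j k)).

(* Elements of N u {N}: Some n is {0, ..., n - 1} and None is N. *)
Definition segment := option nat.

Definition in_segment (J : segment) (j : nat) : bool :=
  if J is Some n then j < n else true.

Definition code_segment (J : segment) : nat :=
  if J is Some n then n.+1 else 0.

(* The values of rel_type outside rel_syms are irrelevant. *)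
Record language := Language {
  sorts : segment;
  rel_syms : segment;
  rel_type : nat -> seq nat
}.

Definition is_language (L : language) : Prop :=
  forall i, in_segment (rel_syms L) i ->
    all (in_segment (sorts L)) (rel_type L i).

Record structure := Structure {
  dom : set nat;
  sort_int : nat -> set nat;
  rel_int : nat -> set (seq nat)
}.

Definition has_type (M : structure) (t : seq nat) (b : seq nat) : Prop :=
  size b = size t /\
  forall k, k < size t -> sort_int M (nth 0 t k) (nth 0 b k).

(* Every element of the underlying set has exactly one sort. *)
Definition is_structure (L : language) (M : structure) : Prop :=
  [/\ forall a, dom M a <->
        exists2 j, in_segment (sorts L) j & sort_int M j a,
      forall a j j', in_segment (sorts L) j -> in_segment (sorts L) j' ->
        sort_int M j a -> sort_int M j' a -> j = j'
    & forall i b, in_segment (rel_syms L) i -> rel_int M i b ->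
        has_type M (rel_type L i) b].

(* A variable is a pair (sort, name). *)
Definition var := (nat * nat)%type.

Inductive formula : Type :=
| Eq of var & var
| Rel of nat & seq var
| Bot
| Not of formula
| And of formula & formula
| Or of formula & formula
| Imp of formula & formula
| All of var & formula
| Ex of var & formula.

Fixpoint quantifier_free (f : formula) : bool :=
  match f with
  | Eq _ _ | Rel _ _ | Bot => true
  | Not g => quantifier_free g
  | And g h | Or g h | Imp g h => quantifier_free g && quantifier_free h
  | All _ _ | Ex _ _ => false
  end.

Fixpoint is_formula (L : language) (f : formula) : bool :=
  match f with
  | Eq v w => (v.1 == w.1) && in_segment (sorts L) v.1
  | Rel i vs => in_segment (rel_syms L) i && ([seq v.1 | v <- vs] == rel_type L i)
  | Bot => true
  | Not g => is_formula L g
  | And g h | Or g h | Imp g h => is_formula L g && is_formula L h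
  | All v g | Ex v g => in_segment (sorts L) v.1 && is_formula L g
  end.

Fixpoint free_vars (f : formula) : seq var :=
  match f with
  | Eq v w => [:: v; w]
  | Rel _ vs => vs
  | Bot => [::]
  | Not g => free_vars g
  | And g h | Or g h | Imp g h => free_vars g ++ free_vars h
  | All v g | Ex v g => [seq w <- free_vars g | w != v]
  end.

Fixpoint sat (M : structure) (s : var -> nat) (f : formula) : Prop :=
  match f with
  | Eq v w => s v = s w
  | Rel i vs => rel_int M i [seq s v | v <- vs]
  | Bot => False
  | Not g => ~ sat M s g
  | And g h => sat M s g /\ sat M s h
  | Or g h => sat M s g \/ sat M s h
  | Imp g h => sat M s g -> sat M s h
  | All v g => forall a, sort_int M v.1 a -> sat M [eta s with v |-> a] g
  | Ex v g => exists2 a, sort_int M v.1 a & sat M [eta s with v |-> a] g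
  end.

Record pformula := PFormula {
  fml : formula;
  xvars : seq var;
  yvars : seq var
}.

Definition is_qf_pformula (L : language) (F : pformula) : Prop :=
  [/\ quantifier_free (fml F), is_formula L (fml F),
      uniq (xvars F ++ yvars F)
    & xvars F ++ yvars F =i free_vars (fml F)].

Definition var_type (vs : seq var) : seq nat := [seq v.1 | v <- vs].

Definition solutions (M : structure) (F : pformula) (a : seq nat) :
    set (seq nat) :=
  [set b | has_type M (var_type (yvars F)) b /\
     sat M (fun v => nth 0 (a ++ b) (index v (xvars F ++ yvars F))) (fml F)].

Definition code_var (v : var) : nat := cpair v.1 v.2.

Fixpoint code_formula (f : formula) : nat :=
  match f with
  | Eq v w => cpair 0 (cpair (code_var v) (code_var w))
  | Rel i vs => cpair 1 (cpair i (code_seq [seq code_var v | v <- vs]))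
  | Bot => cpair 2 0
  | Not g => cpair 3 (code_formula g)
  | And g h => cpair 4 (cpair (code_formula g) (code_formula h))
  | Or g h => cpair 5 (cpair (code_formula g) (code_formula h))
  | Imp g h => cpair 6 (cpair (code_formula g) (code_formula h))
  | All v g => cpair 7 (cpair (code_var v) (code_formula g))
  | Ex v g => cpair 8 (cpair (code_var v) (code_formula g))
  end.

Definition code_pformula (F : pformula) : nat :=
  cpair (code_formula (fml F))
    (cpair (code_seq [seq code_var v | v <- xvars F])
           (code_seq [seq code_var v | v <- yvars F])).

Definition is_language_code (e : nat) (L : language) : Prop :=
  is_language L /\
  exists2 t, e = cpair (code_segment (sorts L))
                       (cpair (code_segment (rel_syms L)) t) &
    forall i, in_segment (rel_syms L) i ->
      phi set0 t i (code_seq (rel_type L i)).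

Definition sort_graph (L : language) (M : structure) : set nat :=
  [set n | exists a j,
     [/\ n = cpair a j, in_segment (sorts L) j & sort_int M j a]].

Definition rel_graph (L : language) (M : structure) : set nat :=
  [set n | exists b i,
     [/\ n = cpair (code_seq b) i, in_segment (rel_syms L) i
       & rel_int M i b]].

Definition is_structure_code (e : nat) (L : language) (M : structure) : Prop :=
  is_structure L M /\
  exists d s r,
    [/\ e = cpair d (cpair s r), decides set0 d (dom M),
        decides set0 s (sort_graph L M) & decides set0 r (rel_graph L M)].

(* c is in CompStr, with L_c = L and M_c = M. *)
Definition codes (c : nat) (L : language) (M : structure) : Prop :=
  exists l m, [/\ phi set0 c 0 l, phi set0 c 1 m,
    is_language_code l L & is_structure_code m L M].

Definition ACL0 (L : language) (M : structure) : set nat :=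
  [set n | exists F a,
     [/\ n = cpair (code_pformula F) (code_seq a), is_qf_pformula L F,
         has_type M (var_type (xvars F)) a & finite_set (solutions M F a)]].

Definition cl1 (M : structure) (Phi : set pformula) (B : set nat) : set nat :=
  B `|` [set b | exists F a d,
    [/\ Phi F,
        has_type M (var_type (xvars F)) a /\ (forall e, e \in a -> B e),
        finite_set (solutions M F a), solutions M F a d & b \in d]].

Definition acl (M : structure) (Phi : set pformula) (B : set nat) : set nat :=
  \bigcup_m iter m (cl1 M Phi) B.

(* {(a, A) : A a finite subset of M, a in acl(A)}, A given by its canonical
   index. *)
Definition acl_set (M : structure) (Phi : set pformula) : set nat :=
  [set n | exists a u,
     [/\ n = cpair a u, canonical_set u `<=` dom M
       & acl M Phi (canonical_set u) a]].

(* Main.v *)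
Require Import Defs.
From mathcomp Require Import all_boot.
From mathcomp Require Import boolp classical_sets functions cardinality.
From mathcomp Require Import zify.

Set Implicit Arguments.
Unset Strict Implicit.
Unset Printing Implicit Defensive.

Local Open Scope classical_set_scope.

(** Membership in the algebraic closure is witnessed by a finite object: a tree
    of instances of formulas of [Phi], whose nodes exhibit solutions. All that
    has to be verified about such a tree is semi-decidable, except that the
    formula instances in it have finitely many solutions. Hence the closure is
    enumerable from ACL0.

    To make this precise once and for all, everything that has to be verified
    is expressed as derivability from one finite list of Horn clauses over
    natural numbers: the results of programs (a universal machine), the
    truth values of quantifier-free formulas, membership in finite sets given by
    canonical indices, and the closure itself. Finiteness enters as hypotheses,
    which an oracle may grant. A proof is a coded sequence of clause instances;
    whether a number codes a proof is decided by one program that works for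
    every oracle ([computable_is_proof]), and a fact is derivable exactly when
    it has a proof ([proof_sound], [proof_complete]). The clauses hold in the
    intended model ([derives_sound]), and they derive every true fact that is
    needed ([goal_complete]). The oracle ACL0 therefore gives the first index.

    For the second index, no oracle decides the hypotheses of a proof. A set of
    solutions is finite when the codes of its elements are bounded, that
    is, when no proof derives a solution beyond some [N]. So a point is in the
    closure when there are a proof [s] and a number [N] such that no number [k]
    encodes a hypothesis of [s] with the proof of a solution beyond [N]: this is
    an existential quantifier followed by a universal one over a decidable
    condition ([finitely_solvable_bounded], [ACL0_bounded]).

    Both indices depend computably on the parameters because the parameters are
    only written into a fixed program ([parameter_theorem]). *)

Arguments cpair : simpl never.

(** * Decoding pairs and sequences *)

Lemma triangleS n : ((n.+1 * n.+2)./2 = (n * n.+1)./2 + n.+1)%N.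
Proof.
have -> : n.+1 * n.+2 = n * n.+1 + n.+1.*2 by lia.
by rewrite halfD odd_double andbF doubleK.
Qed.

Lemma cpair0S a : cpair 0 a.+1 = (cpair a 0).+1.
Proof. by rewrite /cpair addn0 add0n triangleS addn0 addnS. Qed.

Lemma cpairSn a b : cpair a.+1 b = (cpair a b.+1).+1.
Proof. by rewrite /cpair addSn -addnS addnS. Qed.

Definition next_pair (ab : nat * nat) : nat * nat :=
  if ab.2 is b.+1 then (ab.1.+1, b) else (0, ab.1.+1).

Definition unpair n := iter n next_pair (0, 0).
Definition pfst n := (unpair n).1.
Definition psnd n := (unpair n).2.

(** Cantor's enumeration visits the pairs in the order of [next_pair]. *)
Lemma unpairK n : cpair (pfst n) (psnd n) = n.
Proof.
rewrite /pfst /psnd; elim: n => //= n.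
by case: (unpair n) => a [|b] /= <-; rewrite /next_pair /= (cpair0S, cpairSn).
Qed.

Lemma leq_triangle : {homo (fun n => (n * n.+1)./2) : m n / m <= n}.
Proof. by move=> m n le_mn; apply/half_leq/leq_mul. Qed.

Lemma cpair_lt_diag a b c d : a + b < c + d -> cpair a b < cpair c d.
Proof.
move=> lt; have := leq_triangle lt; rewrite triangleS /cpair.
by move: ((_ * _)./2) ((_ * _)./2) => x y; lia.
Qed.

Lemma cpair_inj a b c d : cpair a b = cpair c d -> a = c /\ b = d.
Proof.
move=> eq_p; have eq_s : a + b = c + d.
  by case: (ltngtP (a + b) (c + d)) => // /cpair_lt_diag; rewrite eq_p ltnn.
by move: eq_p; rewrite /cpair eq_s => /addnI ac; lia.
Qed.

Lemma pfstK a b : pfst (cpair a b) = a.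
Proof. by case: (cpair_inj (unpairK (cpair a b))). Qed.

Lemma psndK a b : psnd (cpair a b) = b.
Proof. by case: (cpair_inj (unpairK (cpair a b))). Qed.

Lemma leq_psnd n : psnd n <= n.
Proof.
rewrite -[leqRHS]unpairK /cpair; set a := pfst n; set b := psnd n.
have : a + b <= ((a + b) * (a + b).+1)./2.
  by elim: (a + b) => // k IHk; rewrite triangleS; lia.
lia.
Qed.

Lemma code_seq_inj : injective code_seq.
Proof. by elim=> [|x s IHs] [|y t] //= [] /cpair_inj[-> /IHs->]. Qed.

Lemma leq_code_seq s : size s <= code_seq s.
Proof.
elim: s => //= x s IHs; rewrite ltnS (leq_trans IHs)//.
by rewrite -{1}(psndK x (code_seq s)) leq_psnd.
Qed.

Fixpoint decode_fuel k n : seq nat :=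
  if k is k'.+1 then
    if n is m.+1 then pfst m :: decode_fuel k' (psnd m) else [::]
  else [::].

Definition decode n := decode_fuel n n.

Lemma decodeK : cancel decode code_seq.
Proof.
suff decode_fuelK k n : n <= k -> code_seq (decode_fuel k n) = n.
  by move=> n; apply: decode_fuelK.
elim: k n => [|k IHk] [|n] //= le_nk.
by rewrite IHk ?unpairK// (leq_trans (leq_psnd n)).
Qed.

Lemma code_seqK : cancel code_seq decode.
Proof. by move=> s; apply: code_seq_inj; rewrite decodeK. Qed.

Lemma decode_nil : decode 0 = [::]. Proof. by []. Qed.

Lemma decode_cons x t : decode (cpair x t).+1 = x :: decode t.
Proof. by apply: code_seq_inj; rewrite decodeK /= decodeK. Qed.

Opaque decode.

(** * Total computable functionals *)

(** Programs compute partial functions: the least number operator is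
    single-valued because a smaller zero would contradict definedness with a
    positive value below the larger one. *)
Lemma run_fun X P n m m' : run X P n m -> run X P n m' -> m = m'.
Proof.
elim: P n m m' => /=.
- by move=> n m m' -> ->.
- by move=> n m m' -> ->.
- by move=> n m m' [b ->] [b'] /cpair_inj[].
- by move=> n m m' [b ->] [b'] /cpair_inj[].
- by move=> n m m' [[? ->]|[? ->]] [[? ->]|[? ->]].
- move=> f IHf g IHg n m m' [a [b [fa gb ->]]] [a' [b' [fa' gb' ->]]].
  by rewrite (IHf _ _ _ fa fa') (IHg _ _ _ gb gb').
- move=> f IHf g IHg n m m' [k gk fm] [k' gk' fm'].
  by move: gk' fm' => /(IHg _ _ _ gk) <- /(IHf _ _ _ fm).
- move=> f IHf g IHg n m m' [a [k [h [-> h0 hS ->]]]].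
  move=> [a' [k' [h' [/cpair_inj[<- <-] h0' hS' ->]]]].
  elim: k hS hS' => [|k IHk] hS hS'; first exact: IHf h0 h0'.
  have eq_k : h k = h' k by apply: IHk => i lt_ik; [apply: hS|apply: hS']; apply: ltnW.
  by have := hS' k (ltnSn k); rewrite -eq_k; apply/IHg/hS.
- move=> f IHf n m m' [fm lt_m] [fm' lt_m'].
  case: (ltngtP m m') => // [/lt_m'[r]|/lt_m[r]] fr.
  + by have := IHf _ _ _ fm fr.
  + by have := IHf _ _ _ fm' fr.
Qed.

(** One program has to serve all oracles, because the index of a relativized
    set is computed before the oracle is known. *)
Definition computable (F : set nat -> nat -> nat) : Prop :=
  exists P, forall X n, run X P n (F X n).


Lemma computable_ext F G :
  (forall X n, F X n = G X n) -> computable F -> computable G.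
Proof. by move=> eqFG [P FP]; exists P => X n; rewrite -eqFG. Qed.

Lemma run_id X n : run X (Pair Fst Snd) n n.
Proof.
exists (pfst n), (psnd n).
by split; [exists (psnd n)|exists (pfst n)|]; rewrite unpairK.
Qed.

Lemma computable_id : computable (fun _ n => n).
Proof. by exists (Pair Fst Snd) => X n; apply: run_id. Qed.

Lemma computable_comp F G :
  computable F -> computable G -> computable (fun X n => F X (G X n)).
Proof. by move=> [f Ff] [g Gg]; exists (Comp f g) => X n; exists (G X n). Qed.

Lemma computable_succ F : computable F -> computable (fun X n => (F X n).+1).
Proof. by apply: computable_comp (fun _ n => n.+1) _ _; exists Succ. Qed.

Lemma computable_pfst F : computable F -> computable (fun X n => pfst (F X n)).
Proof.
apply: computable_comp (fun _ n => pfst n) _ _; exists Fst => X n.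
by exists (psnd n); rewrite unpairK.
Qed.

Lemma computable_psnd F : computable F -> computable (fun X n => psnd (F X n)).
Proof.
apply: computable_comp (fun _ n => psnd n) _ _; exists Snd => X n.
by exists (pfst n); rewrite unpairK.
Qed.

Lemma computable_oracle F :
  computable F -> computable (fun X n => `[< X (F X n) >]).
Proof.
apply: computable_comp (fun X n => `[< X n >] : nat) _ _; exists Oracle => X n /=.
by case: asboolP; [left|right].
Qed.

Lemma computable_pair F G :
  computable F -> computable G -> computable (fun X n => cpair (F X n) (G X n)).
Proof.
move=> [f Ff] [g Gg]; exists (Pair f g) => X n.
by exists (F X n), (G X n).
Qed.

Lemma computable_const k : computable (fun _ _ => k).
Proof. by elim: k => [|k]; [exists Zero|apply: computable_succ]. Qed.

(** Primitive recursion with the ambient argument as a constant parameter. *)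
Lemma computable_rec F G K : computable F -> computable G -> computable K ->
  computable (fun X n =>
    nat_rect (fun=> nat) (F X n) (fun i r => G X (cpair n (cpair i r))) (K X n)).
Proof.
move=> [f Ff] [g Gg] [k Kk]; exists (Comp (Prec f g) (Pair (Pair Fst Snd) k)) => X n.
exists (cpair n (K X n)); first by exists n, (K X n); split=> //; apply: run_id.
exists n, (K X n), (nat_rect (fun=> nat) (F X n) (fun i r => G X (cpair n (cpair i r)))).
by split=> // i _ /=.
Qed.

Lemma computable_iter F G K : computable F -> computable G -> computable K ->
  computable (fun X n => iter (K X n) (fun r => G X (cpair n r)) (F X n)).
Proof.
move=> cF cG cK; apply: computable_ext (computable_rec
  (G := fun X m => G X (cpair (pfst m) (psnd (psnd m)))) cF _ cK).
  by move=> X n; elim: (K X n) => //= k ->; rewrite pfstK !psndK.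
apply: computable_comp cG _; apply: computable_pair.
  exact/computable_pfst/computable_id.
exact/computable_psnd/computable_psnd/computable_id.
Qed.

Lemma computable_pred F : computable F -> computable (fun X n => (F X n).-1).
Proof.
move=> cF; apply: computable_ext (computable_rec
  (G := fun X m => pfst (psnd m)) (computable_const 0) _ cF).
  by move=> X n; case: (F X n) => //= k; rewrite psndK pfstK.
exact/computable_pfst/computable_psnd/computable_id.
Qed.

Lemma computable_sub F G :
  computable F -> computable G -> computable (fun X n => F X n - G X n).
Proof.
move=> cF cG; apply: computable_ext (computable_iter
  (G := fun X m => (psnd m).-1) cF _ cG).
  move=> X n; elim: (G X n) => [|k /= ->]; first by rewrite subn0.
  by rewrite psndK subnS.
exact/computable_pred/computable_psnd/computable_id.
Qed.

Lemma computable_if (B : set nat -> nat -> bool) F G : computable (fun X n => B X n) ->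
  computable F -> computable G ->
  computable (fun X n => if B X n then F X n else G X n).
Proof.
move=> cB cF cG; apply: computable_ext (computable_rec
  (G := fun X m => F X (pfst m)) cG _ cB).
  by move=> X n; case: (B X n) => //=; rewrite pfstK.
exact: computable_comp cF (computable_pfst computable_id).
Qed.

Lemma computable_eq0 F : computable F -> computable (fun X n => F X n == 0).
Proof.
move=> cF; apply: computable_ext (computable_rec
  (computable_const 1) (computable_const 0) cF).
by move=> X n; case: (F X n).
Qed.

Lemma computable_leq F G :
  computable F -> computable G -> computable (fun X n => F X n <= G X n).
Proof. by move=> cF cG; apply/computable_eq0/computable_sub. Qed.

Lemma computable_negb (B : set nat -> nat -> bool) :
  computable (fun X n => B X n) -> computable (fun X n => ~~ B X n).
Proof.
by move=> /computable_eq0; apply: computable_ext => X n; case: (B X n).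
Qed.

Lemma computable_andb (B C : set nat -> nat -> bool) :
  computable (fun X n => B X n) -> computable (fun X n => C X n) ->
  computable (fun X n => B X n && C X n).
Proof.
move=> cB cC; apply: computable_ext (computable_if cB cC (computable_const 0)).
by move=> X n; case: (B X n).
Qed.

Lemma computable_orb (B C : set nat -> nat -> bool) :
  computable (fun X n => B X n) -> computable (fun X n => C X n) ->
  computable (fun X n => B X n || C X n).
Proof.
move=> cB cC; apply: computable_ext (computable_if cB (computable_const 1) cC).
by move=> X n; case: (B X n).
Qed.

Lemma computable_eq F G :
  computable F -> computable G -> computable (fun X n => F X n == G X n).
Proof.
move=> cF cG; apply: computable_ext (computable_andb
  (computable_leq cF cG) (computable_leq cG cF)).
by move=> X n; rewrite -eqn_leq.
Qed.

(** The test of an entry may inspect the entries behind it; proof checking needs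
    this, since premises are concluded there. *)
Fixpoint suffix_all (Q : nat -> seq nat -> bool) (s : seq nat) : bool :=
  if s is x :: s' then Q x s' && suffix_all Q s' else true.

Lemma computable_suffix_all (Q : set nat -> nat -> nat -> seq nat -> bool) F :
  computable (fun X m => Q X (pfst m) (pfst (psnd m)) (decode (psnd (psnd m)))) ->
  computable F ->
  computable (fun X n => suffix_all (Q X n) (decode (F X n))).
Proof.
move=> cQ cF.
(* The loop drops entries from the coded sequence for as long as the test
   succeeds; the test always succeeds exactly when the loop ends in 0. *)
pose step X m :=
  let t := psnd m in
  if (t != 0) && Q X (pfst m) (pfst t.-1) (decode (psnd t.-1))
  then psnd t.-1 else t.
have cstep : computable step.
  have ct : computable (fun X m => psnd m) by apply/computable_psnd/computable_id.
  have ctl := computable_psnd (computable_pred ct).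
  apply: computable_if => //; apply: computable_andb.
    exact/computable_negb/computable_eq0.
  apply: computable_ext (computable_comp cQ (computable_pair
    (computable_pfst computable_id)
    (computable_pair (computable_pfst (computable_pred ct)) ctl))) => X n.
  by rewrite !(pfstK, psndK).
apply: computable_ext (computable_eq0 (computable_iter cF cstep cF)) => X n.
suff loopE s k : size s <= k ->
    (iter k (fun r => step X (cpair n r)) (code_seq s) == 0) = suffix_all (Q X n) s.
  by rewrite -(loopE _ _ (leq_code_seq _)) decodeK.
elim: s k => [|x s IHs] k.
  by move=> _; elim: k => //= i /eqP->; rewrite /step psndK.
case: k => // k le_sk; rewrite iterSr {2}/step psndK /= !(pfstK, psndK) code_seqK.
case: ifP => /= Qx; first exact: IHs.
by rewrite iter_fix// /step psndK /= !(pfstK, psndK) code_seqK Qx.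
Qed.

Lemma computable_mem F G : computable F -> computable G ->
  computable (fun X n => F X n \in [seq pfst it | it <- decode (G X n)]).
Proof.
move=> cF cG; apply: computable_ext (computable_negb (computable_suffix_all
  (Q := fun X n it _ => F X n != pfst it) _ cG)).
  move=> X n; congr nat_of_bool; elim: (decode _) => //= it s IHs.
  by rewrite negb_and negbK inE IHs.
apply/computable_negb/computable_eq.
  exact/computable_comp/computable_pfst/computable_id.
exact/computable_pfst/computable_pfst/computable_psnd/computable_id.
Qed.

Lemma computable_nth F i :
  computable F -> computable (fun X n => nth 0 (decode (F X n)) i).
Proof.
have decodeE n : decode n = if n is m.+1 then pfst m :: decode (psnd m) else [::].
  by case: n => [|m]; rewrite ?decode_nil// -{1}(unpairK m) decode_cons.
elim: i F => [|i IHi] F cF.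
  apply: computable_ext (computable_pfst (computable_pred cF)) => X n.
  by rewrite decodeE; case: (F X n).
apply: computable_ext (IHi _ (computable_psnd (computable_pred cF))) => X n.
by rewrite [in RHS]decodeE; case: (F X n) => //=; rewrite decode_nil nth_nil.
Qed.

(** The parameters of a program can be hard-wired into it, because the code of a
    program that writes a given number is computed from that number. *)
Lemma parameter_theorem P : exists2 h : nat -> nat -> nat, computable2 h &
  forall X c p n m, run X P (cpair n (cpair c p)) m -> phi X (h c p) n m.
Proof.
pose write k := iter k (Comp Succ) Zero.
have run_write X k n : run X (write k) n k by elim: k => //= k; exists k.
exists (fun c p => code_prog (Comp P (Pair (Pair Fst Snd) (write (cpair c p))))).
  have [e run_e] : computable (fun _ n =>
      code_prog (Comp P (Pair (Pair Fst Snd) (write n)))).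
    apply: computable_pair; first exact: computable_const.
    apply: computable_pair; first exact: computable_const.
    do 2![apply: computable_pair; first exact: computable_const].
    apply: computable_ext (computable_iter (F := fun _ _ => code_prog Zero)
      (G := fun _ m => cpair 6 (cpair (code_prog Succ) (psnd m)))
      (computable_const _) _ computable_id) => [X n|].
      by rewrite /write; elim: {1 3}n => // k IHk; rewrite iterS psndK IHk.
    do 2![apply: computable_pair; first exact: computable_const].
    exact/computable_psnd/computable_id.
  by exists (code_prog e) => c p; exists e.
move=> X c p n m Pm; eexists; first by [].
exists (cpair n (cpair c p)) => //; exists n, (cpair c p); split=> //.
exact: run_id.
Qed.

(** * Horn clauses and their proofs *)

Inductive term : Type :=
| Var of nat | Cst of nat | Suc of term | Par of term & term.

Fixpoint tval (vs : seq nat) (t : term) : nat :=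
  match t with
  | Var i => nth 0 vs i
  | Cst k => k
  | Suc u => (tval vs u).+1
  | Par u v => cpair (tval vs u) (tval vs v)
  end.

Inductive symbol : Type :=
| Hyp | Eval | Pos | Neq | Mem | App | Val | Vals | Typed | Sat | Sol
| Div2 | Bit | InDom | Acl | Goal.

Definition symbol_code (q : symbol) : nat :=
  match q with
  | Hyp => 0 | Eval => 1 | Pos => 2 | Neq => 3 | Mem => 4 | App => 5
  | Val => 6 | Vals => 7 | Typed => 8 | Sat => 9 | Sol => 10 | Div2 => 11
  | Bit => 12 | InDom => 13 | Acl => 14 | Goal => 15
  end.

Definition atom (T : Type) : Type := (symbol * seq T)%type.
Definition clause : Type := (atom term * seq (atom term))%type.

Definition inst (vs : seq nat) (A : atom term) : atom nat :=
  (A.1, [seq tval vs t | t <- A.2]).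

Definition code_atom (A : atom nat) : nat :=
  cpair (symbol_code A.1) (code_seq A.2).

Lemma code_atom_inj : injective code_atom.
Proof.
case=> [q s] [q' s'] /cpair_inj[/= eq_q /code_seq_inj->].
by congr (_, _); case: q q' eq_q => [] [].
Qed.

(** Computes to a plain conjunction on an explicit list, whatever the type of
    the entries. *)
Fixpoint for_all T (P : T -> Prop) (s : seq T) : Prop :=
  if s is x :: s' then P x /\ for_all P s' else True.

Lemma for_all_nth T (P : T -> Prop) x0 s :
  for_all P s <-> forall i, i < size s -> P (nth x0 s i).
Proof.
split; first by elim: s => //= x s IHs [Px Ps] [|i] // /(IHs Ps).
elim: s => //= x s IHs Ps; split; first exact: (Ps 0).
by apply: IHs => i lt_i; apply: (Ps i.+1).
Qed.

Lemma for_all_cat T (P : T -> Prop) s t :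
  for_all P (s ++ t) <-> for_all P s /\ for_all P t.
Proof. by elim: s => [|x s /= ->]; [split=> [|[]]|rewrite and_assoc]. Qed.

Lemma for_all_impl T (P Q : T -> Prop) s :
  (forall x, P x -> Q x) -> for_all P s -> for_all Q s.
Proof. by move=> PQ; elim: s => //= x s IHs [/PQ ? /IHs]. Qed.

Definition closed_under (cls : seq clause) (I : atom nat -> Prop) : Prop :=
  for_all (fun cl => forall vs,
    for_all (fun A => I (inst vs A)) cl.2 -> I (inst vs cl.1)) cls.

Section LeastModel.

Variable clauses : seq clause.
(* Hypotheses come from the oracle alone. *)
Hypothesis heads_not_hyp : all (fun cl => symbol_code cl.1.1 != 0) clauses.

(** The facts derivable from a set of hypotheses are those of the least model,
    taken as the intersection of all models, so that soundness for an
    interpretation only asks for each clause to hold in it. *)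
Definition models (X : set nat) (I : atom nat -> Prop) : Prop :=
  (forall y, X y -> I (Hyp, [:: y])) /\ closed_under clauses I.

Definition derivable (X : set nat) (A : atom nat) : Prop :=
  forall I, models X I -> I A.

Lemma derivable_hyp (X : set nat) y : X y -> derivable X (Hyp, [:: y]).
Proof. by move=> Xy I [hyp _]; apply: hyp. Qed.

Lemma derivable_closed X : closed_under clauses (derivable X).
Proof.
apply: (for_all_nth _ ((Hyp, [::]), [::]) _).2 => i lt_i vs prem I MI.
case: (MI) => _ /(for_all_nth _ ((Hyp, [::]), [::]))/(_ i lt_i vs); apply.
by apply: for_all_impl prem => A; apply.
Qed.

(** A proof is a sequence of steps in which each step comes before those that it
    depends on. A step is a pair of a fact and a witness: either the coded
    valuation of a clause whose premises are concluded further down, or the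
    argument of a hypothesis. *)
Definition is_hyp (it : nat) : bool :=
  pfst it == code_atom (Hyp, [:: psnd it]).

Definition justifies (it : nat) (s : seq nat) (cl : clause) : bool :=
  (pfst it == code_atom (inst (decode (psnd it)) cl.1)) &&
  all (fun A => code_atom (inst (decode (psnd it)) A) \in map pfst s) cl.2.

Definition is_proof : seq nat -> bool :=
  suffix_all (fun it s => is_hyp it || has (justifies it s) clauses).

Definition hyps_hold (X : set nat) : seq nat -> bool :=
  suffix_all (fun it _ => ~~ is_hyp it || `[< X (psnd it) >]).

Lemma proof_sound X s A : is_proof s -> hyps_hold X s ->
  code_atom A \in map pfst s -> derivable X A.
Proof.
elim: s A => // it s IHs A /andP[it_ok s_ok] /andP[it_X s_X].
rewrite /= inE => /orP[/eqP eqA|]; last exact: IHs.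
case/orP: it_ok it_X => [hyp_it|].
  rewrite hyp_it => /asboolP Xy; move: hyp_it; rewrite /is_hyp -eqA.
  by move=> /eqP/code_atom_inj->; apply: derivable_hyp.
case/(has_nthP ((Hyp, [::]), [::])) => i lt_i.
case/andP; rewrite -eqA => /eqP/code_atom_inj-> /(all_nthP (Hyp, [::])) prems _.
apply: ((for_all_nth _ ((Hyp, [::]), [::]) _).1 (derivable_closed X) i lt_i).
by apply: (for_all_nth _ (Hyp, [::]) _).2 => j lt_j; exact: IHs s_ok s_X (prems j lt_j).
Qed.

Lemma proof_cat X s t : is_proof s -> is_proof t -> hyps_hold X s -> hyps_hold X t ->
  is_proof (s ++ t) /\ hyps_hold X (s ++ t).
Proof.
elim: s => // it s IHs /andP[it_ok s_ok] t_ok /andP[it_X s_X] t_X.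
have [st_ok st_X] := IHs s_ok t_ok s_X t_X.
split; apply/andP; split=> //; apply/orP.
case/orP: it_ok => [|just]; [by left|right].
apply: sub_has just => cl /andP[eq_it prems]; apply/andP; split=> //.
apply: sub_all prems => A /=.
by rewrite map_cat mem_cat => ->.
Qed.

(** The facts that have a proof form a model: proofs of the premises are
    concatenated and the instance of the clause is put in front. *)
Lemma proof_complete X A : derivable X A ->
  exists s, [/\ is_proof s, hyps_hold X s & code_atom A \in map pfst s].
Proof.
move=> /(_ (fun B => exists s,
  [/\ is_proof s, hyps_hold X s & code_atom B \in map pfst s])); apply.
split=> [y Xy|].
  exists [:: cpair (code_atom (Hyp, [:: y])) y].
  by rewrite /is_proof /hyps_hold /= /is_hyp pfstK psndK eqxx mem_seq1 eqxx asboolT.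
apply: (for_all_nth _ ((Hyp, [::]), [::]) _).2 => i lt_i vs prems.
move: (all_nthP ((Hyp, [::]), [::]) heads_not_hyp i lt_i) prems.
set cl := nth _ _ i => head_cl prems.
have [s [s_ok s_X s_prems]] : exists s, [/\ is_proof s, hyps_hold X s &
    all (fun B => code_atom (inst vs B) \in map pfst s) cl.2].
  elim: cl.2 prems => [|B Bs IHs] /=; first by exists [::].
  case=> [[s [s_ok s_X s_B]] /IHs[t [t_ok t_X t_Bs]]].
  exists (s ++ t); have [-> ->] := proof_cat s_ok t_ok s_X t_X; split=> //.
  apply/andP; split; first by rewrite map_cat mem_cat s_B.
  apply: sub_all t_Bs => C /=.
  by rewrite map_cat mem_cat => ->; rewrite orbT.
exists (cpair (code_atom (inst vs cl.1)) (code_seq vs) :: s).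
split; last by rewrite /= pfstK mem_head.
- apply/andP; split=> //; apply/orP; right.
  apply/(has_nthP ((Hyp, [::]), [::])); exists i => //.
  by rewrite /justifies pfstK psndK code_seqK eqxx.
- apply/andP; split=> //; apply/orP; left; apply: contraNneq head_cl.
  by rewrite pfstK psndK => /cpair_inj[/= ->].
Qed.

(** A fact that states a hypothesis can only enter a proof as a hypothesis,
    never through a clause. *)
Lemma hyps_holdP (X : set nat) s y : is_proof s -> hyps_hold X s ->
  code_atom (Hyp, [:: y]) \in map pfst s -> X y.
Proof.
elim: s => // it s IHs /andP[it_ok s_ok] /andP[it_X s_X].
rewrite /= inE => /orP[/eqP eqA|]; last exact: IHs.
case/orP: it_ok it_X => [hyp_it|].
  rewrite hyp_it => /asboolP Xy; move: hyp_it; rewrite /is_hyp -eqA.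
  by move=> /eqP/code_atom_inj[->].
case/(has_nthP ((Hyp, [::]), [::])) => i lt_i.
case/andP; rewrite -eqA => /eqP/code_atom_inj[eqH _].
by have := all_nthP ((Hyp, [::]), [::]) heads_not_hyp i lt_i; rewrite -eqH.
Qed.

(** Every accepted proof is a derivation from the hypotheses that occur in it,
    so an oracle-free search for proofs loses nothing; what remains is to know
    that these hypotheses are true. *)
Lemma hyps_hold_self s :
  hyps_hold [set y | code_atom (Hyp, [:: y]) \in map pfst s] s.
Proof.
suff sub_hold t : {subset map pfst t <= map pfst s} ->
    hyps_hold [set y | code_atom (Hyp, [:: y]) \in map pfst s] t by exact: sub_hold.
elim: t => // it t IHt sub_t; apply/andP; split; last first.
  by apply: IHt => x x_t; apply: sub_t; rewrite inE x_t orbT.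
case: (boolP (is_hyp it)) => //= /eqP eq_it; apply/asboolP => /=.
by apply: sub_t; rewrite -eq_it mem_head.
Qed.

Lemma computable_tval F t :
  computable F -> computable (fun X n => tval (decode (F X n)) t).
Proof.
move=> cF; elim: t => [i|k|t IHt|t IHt u IHu] /=.
- exact: computable_nth.
- exact: computable_const.
- exact: computable_succ.
- exact: computable_pair.
Qed.

Lemma computable_code_inst F A :
  computable F -> computable (fun X n => code_atom (inst (decode (F X n)) A)).
Proof.
move=> cF; apply: computable_pair; first exact: computable_const.
case: A => q; elim=> [|t s IHs] /=; first exact: computable_const.
exact/computable_succ/computable_pair/IHs/computable_tval.
Qed.

Lemma computable_is_hyp F :
  computable F -> computable (fun X n => is_hyp (F X n)).
Proof.
move=> cF; apply: computable_eq; first exact: computable_pfst.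
apply: computable_pair; first exact: computable_const.
apply/computable_succ/computable_pair; first exact: computable_psnd.
exact: computable_const.
Qed.

Lemma computable_justifies F G cl : computable F -> computable G ->
  computable (fun X n => justifies (F X n) (decode (G X n)) cl).
Proof.
move=> cF cG; have cw := computable_psnd cF.
apply: computable_andb.
  by apply: computable_eq; [apply: computable_pfst|apply: computable_code_inst].
elim: cl.2 => [|A s IHs] /=; first exact: computable_const.
apply: computable_andb IHs.
by apply: computable_mem => //; apply: computable_code_inst.
Qed.

Lemma computable_is_proof F :
  computable F -> computable (fun X n => is_proof (decode (F X n))).
Proof.
apply: computable_suffix_all
  (fun _ _ it s => is_hyp it || has (justifies it s) clauses) _ _.
have cit : computable (fun X n => pfst (psnd n)).
  exact/computable_pfst/computable_psnd/computable_id.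
apply: computable_orb; first exact: computable_is_hyp.
elim: (clauses) => [|cl cls IHcls] /=; first exact: computable_const.
apply: computable_orb IHcls; apply: computable_justifies => //.
exact/computable_psnd/computable_psnd/computable_id.
Qed.

Lemma computable_hyps_hold F :
  computable F -> computable (fun X n => hyps_hold X (decode (F X n))).
Proof.
apply: computable_suffix_all (fun X _ it _ => ~~ is_hyp it || `[< X (psnd it) >]) _ _.
have cit : computable (fun X n => pfst (psnd n)).
  exact/computable_pfst/computable_psnd/computable_id.
apply: computable_orb; first exact/computable_negb/computable_is_hyp.
exact/computable_oracle/computable_psnd.
Qed.

End LeastModel.

(** * The clauses *)

Local Notation "<< x , y >>" := (Par x y) (at level 0, x, y at level 99).
Local Notation "A :- As" := ((A, As) : clause) (at level 90, only parsing).

(** [Eval e n m]: the program with code [e] sends [n] to [m] without oracle.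
    [Pos e n m]: it sends [n] paired with each number below [m] to a positive
    number. *)
Definition program_clauses : seq clause :=
  let n := Var 0 in let m := Var 1 in let f := Var 2 in let g := Var 3 in
  let k := Var 4 in let i := Var 5 in
  [:: (Eval, [:: <<Cst 0, Cst 0>>; n; Cst 0]) :- [::];
      (Eval, [:: <<Cst 1, Cst 0>>; n; Suc n]) :- [::];
      (Eval, [:: <<Cst 2, Cst 0>>; <<m, n>>; m]) :- [::];
      (Eval, [:: <<Cst 3, Cst 0>>; <<n, m>>; m]) :- [::];
      (Eval, [:: <<Cst 4, Cst 0>>; n; Cst 0]) :- [::];
      (Eval, [:: <<Cst 5, <<f, g>>>>; n; <<m, k>>]) :-
        [:: (Eval, [:: f; n; m]); (Eval, [:: g; n; k])];
      (Eval, [:: <<Cst 6, <<f, g>>>>; n; m]) :-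
        [:: (Eval, [:: g; n; k]); (Eval, [:: f; k; m])];
      (Eval, [:: <<Cst 7, <<f, g>>>>; <<n, Cst 0>>; m]) :-
        [:: (Eval, [:: f; n; m])];
      (Eval, [:: <<Cst 7, <<f, g>>>>; <<n, Suc i>>; m]) :-
        [:: (Eval, [:: <<Cst 7, <<f, g>>>>; <<n, i>>; k]);
            (Eval, [:: g; <<n, <<i, k>>>>; m])];
      (Eval, [:: <<Cst 8, f>>; n; m]) :-
        [:: (Pos, [:: f; n; m]); (Eval, [:: f; <<n, m>>; Cst 0])];
      (Pos, [:: f; n; Cst 0]) :- [::];
      (Pos, [:: f; n; Suc i]) :-
        [:: (Pos, [:: f; n; i]); (Eval, [:: f; <<n, i>>; Suc k])]].

(** [Val vs bs v x]: the assignment that maps the entries of [vs] to those of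
    [bs] maps [v] to [x]; [Vals] does the same for sequences. *)
Definition sequence_clauses : seq clause :=
  let x := Var 0 in let s := Var 1 in let y := Var 2 in let t := Var 3 in
  let v := Var 4 in let u := Var 5 in
  [:: (Neq, [:: Cst 0; Suc x]) :- [::];
      (Neq, [:: Suc x; Cst 0]) :- [::];
      (Neq, [:: Suc x; Suc y]) :- [:: (Neq, [:: x; y])];
      (Mem, [:: x; Suc <<x, s>>]) :- [::];
      (Mem, [:: x; Suc <<y, s>>]) :- [:: (Mem, [:: x; s])];
      (App, [:: Cst 0; t; t]) :- [::];
      (App, [:: Suc <<x, s>>; t; Suc <<x, u>>]) :- [:: (App, [:: s; t; u])];
      (Val, [:: Suc <<v, s>>; Suc <<x, t>>; v; x]) :- [::];
      (Val, [:: Suc <<u, s>>; Suc <<y, t>>; v; x]) :- [:: (Val, [:: s; t; v; x])];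
      (Vals, [:: s; t; Cst 0; Cst 0]) :- [::];
      (Vals, [:: s; t; Suc <<v, u>>; Suc <<x, y>>]) :-
        [:: (Val, [:: s; t; v; x]); (Vals, [:: s; t; u; y])]].

Definition connective_clauses (tag : nat) (op : bool -> bool -> bool) :
    seq clause :=
  let e := Var 0 in let vs := Var 1 in let bs := Var 2 in
  let f := Var 3 in let g := Var 4 in
  [seq (Sat, [:: e; vs; bs; <<Cst tag, <<f, g>>>>; Cst (op x y)]) :-
         [:: (Sat, [:: e; vs; bs; f; Cst x]); (Sat, [:: e; vs; bs; g; Cst y])]
     | x <- [:: true; false], y <- [:: true; false]].

(** [Typed e vs bs]: by the program [e] for the sorts, the type of [bs] is that
    of the variables [vs]. [Sat e vs bs f t]: by the program [e] for the
    relations, [t] is the truth value of the formula [f]. Truth and falsity are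
    derived together, since negations of atoms have to be proved as well. *)
Definition formula_clauses : seq clause :=
  let e := Var 0 in let vs := Var 1 in let bs := Var 2 in
  let f := Var 3 in let g := Var 4 in let x := Var 5 in let y := Var 6 in
  [:: (Typed, [:: e; Cst 0; Cst 0]) :- [::];
      (Typed, [:: e; Suc <<<<f, g>>, vs>>; Suc <<x, bs>>]) :-
        [:: (Eval, [:: e; <<x, f>>; Cst 1]); (Typed, [:: e; vs; bs])];
      (Sat, [:: e; vs; bs; <<Cst 0, <<f, g>>>>; Cst 1]) :-
        [:: (Val, [:: vs; bs; f; x]); (Val, [:: vs; bs; g; x])];
      (Sat, [:: e; vs; bs; <<Cst 0, <<f, g>>>>; Cst 0]) :-
        [:: (Val, [:: vs; bs; f; x]); (Val, [:: vs; bs; g; y]);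
            (Neq, [:: x; y])];
      (Sat, [:: e; vs; bs; <<Cst 1, <<f, g>>>>; y]) :-
        [:: (Vals, [:: vs; bs; g; x]); (Eval, [:: e; <<x, f>>; y])];
      (Sat, [:: e; vs; bs; <<Cst 2, Cst 0>>; Cst 0]) :- [::];
      (Sat, [:: e; vs; bs; <<Cst 3, f>>; Cst 0]) :-
        [:: (Sat, [:: e; vs; bs; f; Cst 1])];
      (Sat, [:: e; vs; bs; <<Cst 3, f>>; Cst 1]) :-
        [:: (Sat, [:: e; vs; bs; f; Cst 0])]]
  ++ connective_clauses 4 andb ++ connective_clauses 5 orb
  ++ connective_clauses 6 implb.

(** [InDom e u k]: the program [e] accepts [k + i] for every [i] in the finite
    set [u]. *)
Definition finite_set_clauses : seq clause :=
  let u := Var 0 in let h := Var 1 in let i := Var 2 in let e := Var 3 in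
  let k := Var 4 in
  [:: (Div2, [:: Cst 0; Cst 0; Cst 0]) :- [::];
      (Div2, [:: Cst 1; Cst 0; Cst 1]) :- [::];
      (Div2, [:: Suc (Suc u); Suc h; i]) :- [:: (Div2, [:: u; h; i])];
      (Bit, [:: u; Cst 0]) :- [:: (Div2, [:: u; h; Cst 1])];
      (Bit, [:: u; Suc i]) :- [:: (Div2, [:: u; h; k]); (Bit, [:: h; i])];
      (InDom, [:: e; Cst 0; k]) :- [::];
      (InDom, [:: e; u; k]) :-
        [:: (Div2, [:: u; h; Cst 0]); (InDom, [:: e; h; Suc k])];
      (InDom, [:: e; u; k]) :-
        [:: (Div2, [:: u; h; Cst 1]); (Eval, [:: e; k; Cst 1]);
            (InDom, [:: e; h; Suc k])]].

(** [Acl c p u bs]: all entries of [bs] are algebraic over the finite set [u].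
    The hypothesis on a formula with parameters says that it has finitely many
    solutions, which no computation can certify. *)
Definition acl_clauses : seq clause :=
  let c := Var 0 in let p := Var 1 in let u := Var 2 in let b := Var 3 in
  let bs := Var 4 in let f := Var 5 in let xs := Var 6 in let ys := Var 7 in
  let a := Var 8 in let d := Var 9 in let dom_e := Var 10 in
  let sort_e := Var 11 in let rel_e := Var 12 in let vs := Var 13 in
  let ad := Var 14 in
  let structure_code :=
    (Eval, [:: c; Cst 1; <<dom_e, <<sort_e, rel_e>>>>]) in
  [:: (Sol, [:: c; <<f, <<xs, ys>>>>; a; d]) :-
        [:: structure_code; (Typed, [:: sort_e; ys; d]);
            (App, [:: xs; ys; vs]); (App, [:: a; d; ad]);
            (Sat, [:: rel_e; vs; ad; f; Cst 1])];
      (Acl, [:: c; p; u; Cst 0]) :- [::];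
      (Acl, [:: c; p; u; Suc <<b, bs>>]) :-
        [:: (Bit, [:: u; b]); (Acl, [:: c; p; u; bs])];
      (Acl, [:: c; p; u; Suc <<b, bs>>]) :-
        [:: (Eval, [:: p; <<f, <<xs, ys>>>>; Cst 1]); structure_code;
            (Typed, [:: sort_e; xs; a]); (Acl, [:: c; p; u; a]);
            (Hyp, [:: <<<<f, <<xs, ys>>>>, a>>]);
            (Sol, [:: c; <<f, <<xs, ys>>>>; a; d]); (Mem, [:: b; d]);
            (Acl, [:: c; p; u; bs])];
      (Goal, [:: c; p; <<b, u>>]) :-
        [:: structure_code; (InDom, [:: dom_e; u; Cst 0]);
            (Acl, [:: c; p; u; Suc <<b, Cst 0>>])]].

Definition clauses : seq clause :=
  program_clauses ++ sequence_clauses ++ formula_clauses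
  ++ finite_set_clauses ++ acl_clauses.

Lemma closed_clauses I : closed_under clauses I <->
  [/\ closed_under program_clauses I, closed_under sequence_clauses I,
      closed_under formula_clauses I, closed_under finite_set_clauses I
    & closed_under acl_clauses I].
Proof.
rewrite /closed_under /clauses; split; last first.
  by case=> ? ? ? ? ?; do 4![apply/for_all_cat; apply: conj => //].
move=> /for_all_cat[? /for_all_cat[? /for_all_cat[? /for_all_cat[? ?]]]].
exact: And5.
Qed.

Notation derives := (derivable clauses).

(** * Soundness of the clauses *)

Definition value (vs bs : nat) (v : nat) : nat :=
  nth 0 (decode bs) (index v (decode vs)).

Lemma value_cons v s x t w : value (cpair v s).+1 (cpair x t).+1 w =
  if v == w then x else value s t w.
Proof. by rewrite /value !decode_cons /=; case: eqP. Qed.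

Lemma canonical_set0 u : canonical_set u 0 = odd u.
Proof. by rewrite /canonical_set /= divn1. Qed.

Lemma canonical_setS u i : canonical_set u i.+1 = canonical_set u./2 i.
Proof. by rewrite /canonical_set /= expnS divnMA divn2. Qed.

Lemma leq_iter_cl1 M Phi B m n : m <= n ->
  iter m (cl1 M Phi) B `<=` iter n (cl1 M Phi) B.
Proof.
move=> /subnK<-; elim: (n - m) => [|k IHk] b // /IHk.
by rewrite addSn iterS; left.
Qed.

(** The closure process stabilizes because formulas have finitely many
    parameters, which all appear at one finite stage. *)
Lemma cl1_acl M Phi B : cl1 M Phi (acl M Phi B) `<=` acl M Phi B.
Proof.
move=> b [//|[F [a [d [Phi_F [typed_a acl_a] fin_F sol_d b_d]]]]].
have [m a_m] : exists m, forall e, e \in a -> iter m (cl1 M Phi) B e.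
  elim: {typed_a fin_F sol_d} a acl_a => [|x a IHa] acl_a; first by exists 0.
  have [m x_m] : acl M Phi B x by apply: acl_a; rewrite mem_head.
  have [|n a_n] := IHa; first by move=> e a_e; apply: acl_a; rewrite inE a_e orbT.
  exists (maxn m n) => e; rewrite inE => /predU1P[->|/a_n].
    exact: leq_iter_cl1 (leq_maxl _ _) _ _.
  exact/leq_iter_cl1/leq_maxr.
by exists m.+1 => //; right; exists F, a, d.
Qed.

Lemma code_var_inj : injective code_var.
Proof. by move=> [j x] [k y] /cpair_inj[/= -> ->]. Qed.

Lemma sorts_decode vs e : code_seq (map code_var vs) = e ->
  [seq pfst v | v <- decode e] = var_type vs.
Proof.
by move=> <-; rewrite code_seqK -map_comp; apply: eq_map => v; apply: pfstK.
Qed.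

Section Meaning.

Variables (c p dom_e sort_e rel_e : nat).
Variables (L : language) (M : structure) (Phi : set pformula).
Hypothesis language_L : is_language L.
Hypothesis eval_c : phi set0 c 1 (cpair dom_e (cpair sort_e rel_e)).
Hypothesis decides_dom : decides set0 dom_e (dom M).
Hypothesis decides_sorts : decides set0 sort_e (sort_graph L M).
Hypothesis decides_rels : decides set0 rel_e (rel_graph L M).
Hypothesis Phi_qf : forall F : pformula, Phi F -> is_qf_pformula L F.
Hypothesis decides_Phi : decides set0 p [set code_pformula F | F in Phi].

(** What a hypothesis has to mean for the closure clauses to be sound. It is
    weaker than membership in ACL0, whose elements must also be well formed. *)
Definition finitely_solvable (y : nat) : Prop :=
  forall (F : pformula) a, is_qf_pformula L F ->
    has_type M (var_type (xvars F)) a ->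
    y = cpair (code_pformula F) (code_seq a) -> finite_set (solutions M F a).

(** The intended model. Facts are about codes, and may be derived for codes that
    denote nothing; so each reading is conditional on the codes being those of
    a program, of a formula, or of the given structure. *)
Definition meaning (A : atom nat) : Prop :=
  match A with
  | (Hyp, [:: y]) => finitely_solvable y
  | (Eval, [:: e; n; m]) => forall P, code_prog P = e -> run set0 P n m
  | (Pos, [:: e; n; m]) => forall P, code_prog P = e ->
      forall i, i < m -> exists r, run set0 P (cpair n i) r.+1
  | (Neq, [:: x; y]) => x <> y
  | (Mem, [:: x; s]) => x \in decode s
  | (App, [:: s; t; u]) => decode u = decode s ++ decode t
  | (Val, [:: vs; bs; v; x]) => uniq (decode vs) ->
      v \in decode vs /\ x = value vs bs v
  | (Vals, [:: vs; bs; ws; xs]) => uniq (decode vs) ->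
      decode xs = [seq value vs bs w | w <- decode ws]
  | (Typed, [:: e; vs; bs]) => e = sort_e ->
      has_type M [seq pfst v | v <- decode vs] (decode bs)
  | (Sat, [:: e; vs; bs; f; t]) => e = rel_e -> uniq (decode vs) ->
      forall F : formula, code_formula F = f -> quantifier_free F -> is_formula L F ->
      t = `[< sat M (value vs bs \o code_var) F >]
  | (Sol, [:: e; f; a; d]) => e = c -> forall F : pformula, code_pformula F = f ->
      is_qf_pformula L F -> solutions M F (decode a) (decode d)
  | (Div2, [:: u; h; t]) => h = u./2 /\ t = odd u
  | (Bit, [:: u; i]) => canonical_set u i
  | (InDom, [:: e; u; k]) => e = dom_e ->
      forall i, canonical_set u i -> dom M (k + i)
  | (Acl, [:: e; q; u; bs]) => e = c -> q = p ->
      forall b, b \in decode bs -> acl M Phi (canonical_set u) b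
  | (Goal, [:: e; q; n]) => e = c -> q = p -> acl_set M Phi n
  | _ => True
  end.

(** Since programs are single-valued, a derived output of a decision program is
    the truth value. *)
Lemma decides_meaning e (A : set nat) n t : decides set0 e A ->
  meaning (Eval, [:: e; n; t]) -> t = `[< A n >].
Proof.
move=> dA; have [yes no] := dA n; rewrite /= => ev.
by case: asboolP => [/yes|/no] [P /ev Pt /(run_fun Pt)].
Qed.

Lemma eval_c_meaning m :
  meaning (Eval, [:: c; 1; m]) -> m = cpair dom_e (cpair sort_e rel_e).
Proof. by case: eval_c => P cP Pm /(_ P cP) /run_fun; apply. Qed.

Local Ltac clauses_of :=
  rewrite /closed_under /=; repeat refine (conj _ _); move=> //.

#[local] Arguments nth : simpl never.

Lemma program_sound : closed_under program_clauses meaning.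
Proof.
clauses_of; move=> vs /=; move: (nth 0 vs 0) (nth 0 vs 1) (nth 0 vs 2)
  (nth 0 vs 3) (nth 0 vs 4) (nth 0 vs 5) => n m f g k i {vs} prems P;
  try case: P => [|||||P Q|P Q|P Q|P] /= /cpair_inj[]//.
- by exists n.
- by exists n.
- by move=> _ _; right; split=> // -[].
- move=> _ /cpair_inj[Pf Qg]; case: prems => run_f [run_g _].
  by exists m, k; split; [apply: run_f|apply: run_g|].
- move=> _ /cpair_inj[Pf Qg]; case: prems => run_g [run_f _].
  by exists k; [apply: run_g|apply: run_f].
- move=> _ /cpair_inj[Pf Qg]; exists n, 0, (fun=> m).
  by split=> //; apply: prems.1.
- move=> _ /cpair_inj[Pf Qg]; case: prems => run_i [run_g _].
  have [|n' [i' [h [/cpair_inj[<- <-] h0 hS eq_k]]]] := run_i (Prec P Q).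
    by rewrite /= Pf Qg.
  (* The history of the recursion is extended by its new last value. *)
  exists n, i.+1, (fun j => if j == i.+1 then m else h j); split=> //=.
    move=> j; rewrite ltnS leq_eqVlt => /predU1P[->|lt_ji].
      by rewrite eqxx ltn_eqF// -eq_k; apply: run_g.
    by rewrite !ltn_eqF// ?(ltn_trans lt_ji)//; apply: hS.
  by rewrite eqxx.
- by move=> _ Pf; split; [apply: prems.2.1|apply: prems.1].
move=> Pf j; rewrite ltnS leq_eqVlt => /predU1P[->|lt_ji].
  by exists k; apply: prems.2.1.
exact: prems.1 lt_ji.
Qed.

Lemma sequence_sound : closed_under sequence_clauses meaning.
Proof.
clauses_of; move=> vs /=; move: (nth 0 vs 0) (nth 0 vs 1) (nth 0 vs 2)
  (nth 0 vs 3) (nth 0 vs 4) (nth 0 vs 5) => x s y t v u {vs};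
  rewrite ?decode_cons ?value_cons.
- by case=> neq_xy _ [].
- by rewrite mem_head.
- by rewrite inE => -[-> _]; rewrite orbT.
- by case=> ->.
- by rewrite mem_head eqxx.
- move=> [vx _] /=/andP[u_s /vx[v_s ->]]; rewrite inE v_s orbT.
  by case: eqP u_s => // ->; rewrite v_s.
- by case=> vx [vxs _] uniq_s /=; rewrite (vx _).2// vxs.
Qed.

Lemma formula_sound : closed_under formula_clauses meaning.
Proof.
clauses_of; move=> vs /=; move: (nth 0 vs 0) (nth 0 vs 1) (nth 0 vs 2)
  (nth 0 vs 3) (nth 0 vs 4) (nth 0 vs 5) (nth 0 vs 6) => e ws bs f g x y {vs};
  move=> prems eq_e;
  try (move=> uniq_ws; case=> [v w|i us||F|F G|F G|F G|v F|v F] /= /cpair_inj[]//).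
- have [ev [typed _]] := prems; have [size_bs sort_bs] := typed eq_e.
  rewrite !decode_cons; split=> [/=|]; first by rewrite size_bs.
  case=> [_ /=|k lt_k]; last exact: sort_bs.
  move: ev; rewrite eq_e => /(decides_meaning decides_sorts).
  by case: asboolP => // -[b [j [/cpair_inj[-> ->] _]]]; rewrite !pfstK.
- move=> _ /cpair_inj[vf wg] _ _; have [vf_x [vg_x _]] := prems.
  by rewrite asboolT// vf wg -(vf_x _).2// -(vg_x _).2.
- move=> _ /cpair_inj[vf wg] _ _; have [vf_x [vg_y [neq_xy _]]] := prems.
  by rewrite asboolF// vf wg -(vf_x _).2// -(vg_y _).2.
- move=> _ /cpair_inj[eq_i us_g] _ /andP[i_L _]; have [vals [ev _]] := prems.
  move: ev; rewrite eq_e -eq_i => /(decides_meaning decides_rels)->.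
  have -> : [seq (value ws bs \o code_var) u | u <- us] = decode x.
    by rewrite vals// -us_g code_seqK -map_comp.
  congr nat_of_bool; apply/asbool_equiv_eq; split=> [[b [j]]|rel_x].
    by move=> [/cpair_inj[-> ->] _]; rewrite code_seqK.
  by exists (decode x), i; rewrite decodeK.
- by rewrite asboolF.
- move=> _ F_f /= F_qf F_L; have := prems.1 eq_e uniq_ws _ F_f F_qf F_L.
  by case: asboolP => // F_true _; rewrite asboolF//; apply.
- move=> _ F_f /= F_qf F_L; have := prems.1 eq_e uniq_ws _ F_f F_qf F_L.
  by case: asboolP => // F_false _; rewrite asboolT.
all: move=> _ /cpair_inj[F_f G_g] /= /andP[F_qf G_qf] /andP[F_L G_L].
all: have [F_t [G_t _]] := prems.
all: have := F_t eq_e uniq_ws _ F_f F_qf F_L.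
all: have := G_t eq_e uniq_ws _ G_g G_qf G_L.
all: by do 2![case: asboolP => // ? _]; case: asboolP => //; tauto.
Qed.

Lemma finite_set_sound : closed_under finite_set_clauses meaning.
Proof.
clauses_of; move=> vs /=; move: (nth 0 vs 0) (nth 0 vs 1) (nth 0 vs 2)
  (nth 0 vs 3) (nth 0 vs 4) => u h i e k {vs}.
- by move=> [[-> ->] _]; rewrite negbK.
- by move=> [[_ u_odd] _]; rewrite canonical_set0; case: odd u_odd.
- by move=> [[-> _] [u_i _]]; rewrite canonical_setS.
- by move=> _ _ i0; rewrite /canonical_set /= div0n.
- move=> [[-> u_even] [in_h _]] eq_e [|j].
    by rewrite canonical_set0; case: odd u_even.
  by rewrite canonical_setS => /(in_h eq_e); rewrite addSnnS.
- move=> [[-> u_odd] [ev [in_h _]]] eq_e [_|j]; last first.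
    by rewrite canonical_setS => /(in_h eq_e); rewrite addSnnS.
  move: ev; rewrite eq_e addn0 => /(decides_meaning decides_dom).
  by case: asboolP.
Qed.

Lemma acl_sound : closed_under acl_clauses meaning.
Proof.
clauses_of; move=> vs /=; move: (nth 0 vs 0) (nth 0 vs 1) (nth 0 vs 2)
  (nth 0 vs 3) (nth 0 vs 4) (nth 0 vs 5) (nth 0 vs 6) (nth 0 vs 7) (nth 0 vs 8)
  (nth 0 vs 9) (nth 0 vs 10) (nth 0 vs 11) (nth 0 vs 12) (nth 0 vs 13)
  (nth 0 vs 14) => c' q u b bs f xs ys a d e1 e2 e3 ws ad {vs}.
- move=> [ev [typed [app_ws [app_ad [satd _]]]]] eq_c F eq_F F_L.
  move: ev; rewrite eq_c => /eval_c_meaning/cpair_inj[_ /cpair_inj[eq2 eq3]].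
  move: eq_F => /cpair_inj[F_f /cpair_inj[xs_F ys_F]]; case: F_L => F_qf F_L F_uniq _.
  move: app_ws; rewrite -xs_F -ys_F !code_seqK -map_cat => def_ws.
  split; first by rewrite -(sorts_decode ys_F); apply: typed.
  have uniq_ws : uniq (decode ws) by rewrite def_ws (map_inj_uniq code_var_inj).
  have := satd eq3 uniq_ws _ F_f F_qf F_L; case: asboolP => // sat_F _.
  congr (sat M _ _): sat_F; apply/funext => v /=.
  by rewrite /value def_ws app_ad (index_map code_var_inj).
- move=> [bit_b [acl_bs _]] eq_c eq_q x.
  rewrite decode_cons inE => /predU1P[->|]; last exact: acl_bs.
  by exists 0.
- move=> [evF [ev [typed [acl_a [hyp [sol [b_d [acl_bs _]]]]]]]] eq_c eq_q x.
  rewrite decode_cons inE => /predU1P[->|]; last exact: acl_bs.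
  move: ev; rewrite eq_c => /eval_c_meaning/cpair_inj[_ /cpair_inj[eq2 eq3]].
  move: evF; rewrite eq_q => /(decides_meaning decides_Phi).
  case: asboolP => // -[F Phi_F code_F] _.
  have typed_a : has_type M (var_type (xvars F)) (decode a).
    move: (code_F) => /cpair_inj[_ /cpair_inj[xs_F _]].
    by rewrite -(sorts_decode xs_F); apply: typed.
  apply: cl1_acl; right; exists F, (decode a), (decode d); split=> //.
  + by split=> // e; apply: acl_a.
  + by apply: hyp typed_a _; [apply: Phi_qf|rewrite code_F decodeK].
  + exact/sol/Phi_qf.
- move=> [ev [in_dom [acl_b _]]] eq_c eq_q.
  move: ev; rewrite eq_c => /eval_c_meaning/cpair_inj[eq1 _].
  exists b, u; split=> //; last by apply: acl_b; rewrite ?decode_cons ?mem_head.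
  by move=> i /(in_dom eq1).
Qed.

Theorem derives_sound (X : set nat) A :
  X `<=` finitely_solvable -> derives X A -> meaning A.
Proof.
move=> fin_X; apply; split=> [y /fin_X|] //; apply/closed_clauses.
split; [exact: program_sound|exact: sequence_sound|exact: formula_sound
       |exact: finite_set_sound|exact: acl_sound].
Qed.

(** * Completeness of the clauses *)

Lemma derives_closed X : closed_under clauses (derives X).
Proof. exact: derivable_closed. Qed.

Lemma program_complete X P n m :
  run set0 P n m -> derives X (Eval, [:: code_prog P; n; m]).
Proof.
case/closed_clauses: (derives_closed X); rewrite /closed_under /=.
move=> [zero [succ [fst [snd [oracle [pair [comp rules]]]]]]] _ _ _ _.
move: rules => [prec0 [precS [mu [pos0 [posS _]]]]].
elim: P n m => [||||| f IHf g IHg | f IHf g IHg | f IHf g IHg | f IHf] n m /=.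
- by move=> ->; apply: (zero [:: n]).
- by move=> ->; apply: (succ [:: n]).
- by move=> [b ->]; apply: (fst [:: b; m]).
- by move=> [a ->]; apply: (snd [:: a; m]).
- by case=> [[]|[_ ->]] //; apply: (oracle [:: n]).
- move=> [a [b [/IHf fa /IHg gb ->]]].
  exact: (pair [:: n; a; code_prog f; code_prog g; b]).
- move=> [k /IHg gk /IHf fm].
  exact: (comp [:: n; m; code_prog f; code_prog g; k]).
- move=> [a [k [h [-> /IHf h0 hS ->]]]].
  elim: k hS => [|k IHk] hS.
    exact: (prec0 [:: a; h 0; code_prog f; code_prog g]).
  apply: (precS [:: a; h k.+1; code_prog f; code_prog g; h k; k]).
  split; first by apply: IHk => i lt_ik; apply/hS/ltnW.
  by split=> //; apply: IHg (hS _ (ltnSn k)).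
move=> [/IHf fm pos_m]; apply: (mu [:: n; m; code_prog f]); split=> //=.
elim: m pos_m {fm} => [|m IHm] pos_m; first exact: (pos0 [:: n; 0; code_prog f]).
have [r /IHf fr] := pos_m m (ltnSn m).
apply: (posS [:: n; 0; code_prog f; 0; r; m]); split=> //.
by apply: IHm => i lt_im; apply/pos_m/ltnW.
Qed.

Lemma decides_complete X e (A : set nat) n :
  decides set0 e A -> derives X (Eval, [:: e; n; `[< A n >] : nat]).
Proof.
move=> /(_ n)[yes no]; case: asboolP => [/yes|/no] [P <-]; exact: program_complete.
Qed.

Lemma neq_complete X x y : x <> y -> derives X (Neq, [:: x; y]).
Proof.
case/closed_clauses: (derives_closed X) => _; rewrite /closed_under /=.
move=> [left [right [both _]]] _ _ _.
elim: x y => [|x IHx] [|y] // neq_xy.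
- exact: (left [:: y]).
- exact: (right [:: x]).
- by apply: (both [:: x; 0; y]); split=> //; apply: IHx => eq_xy; rewrite eq_xy in neq_xy.
Qed.

Lemma mem_complete X x s : x \in s -> derives X (Mem, [:: x; code_seq s]).
Proof.
case/closed_clauses: (derives_closed X) => _; rewrite /closed_under /=.
move=> [_ [_ [_ [here [there _]]]]] _ _ _.
elim: s => // y s IHs; rewrite inE => /predU1P[->|x_s].
  exact: (here [:: y; code_seq s]).
by apply: (there [:: x; code_seq s; y]); split=> //; apply: IHs.
Qed.

Lemma app_complete X s t :
  derives X (App, [:: code_seq s; code_seq t; code_seq (s ++ t)]).
Proof.
case/closed_clauses: (derives_closed X) => _; rewrite /closed_under /=.
move=> [_ [_ [_ [_ [_ [nil [cons _]]]]]]] _ _ _.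
elim: s => [|x s IHs]; first exact: (nil [:: 0; 0; 0; code_seq t]).
by apply: (cons [:: x; code_seq s; 0; code_seq t; 0; code_seq (s ++ t)]).
Qed.

Lemma val_complete X vs bs v : v \in vs -> size vs <= size bs ->
  derives X (Val, [:: code_seq vs; code_seq bs; v; nth 0 bs (index v vs)]).
Proof.
case/closed_clauses: (derives_closed X) => _; rewrite /closed_under /=.
move=> [_ [_ [_ [_ [_ [_ [_ [here [there _]]]]]]]]] _ _ _.
elim: vs bs => [|w vs IHvs] [|b bs] //=; rewrite inE eq_sym.
case: eqP => [->|_] /= v_vs le_size.
  exact: (here [:: b; code_seq vs; 0; code_seq bs; v]).
apply: (there [:: nth 0 bs (index v vs); code_seq vs; b; code_seq bs; v; w]).
by split=> //; apply: IHvs.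
Qed.

Lemma vals_complete X vs bs ws : {subset ws <= vs} -> size vs <= size bs ->
  derives X (Vals, [:: code_seq vs; code_seq bs; code_seq ws;
    code_seq [seq nth 0 bs (index w vs) | w <- ws]]).
Proof.
case/closed_clauses: (derives_closed X) => _; rewrite /closed_under /=.
move=> [_ [_ [_ [_ [_ [_ [_ [_ [_ [nil [cons _]]]]]]]]]]] _ _ _ sub_ws le_size.
elim: ws sub_ws => [|w ws IHws] sub_ws.
  exact: (nil [:: 0; code_seq vs; 0; code_seq bs]).
apply: (cons [:: nth 0 bs (index w vs); code_seq vs;
  code_seq [seq nth 0 bs (index v vs) | v <- ws]; code_seq bs; w; code_seq ws]).
split; first by apply: val_complete => //; apply: sub_ws; rewrite mem_head.
by split=> //; apply: IHws => v v_ws; apply: sub_ws; rewrite inE v_ws orbT.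
Qed.

Lemma typed_complete X vs bs : all (in_segment (sorts L)) (var_type vs) ->
  has_type M (var_type vs) bs ->
  derives X (Typed, [:: sort_e; code_seq (map code_var vs); code_seq bs]).
Proof.
case/closed_clauses: (derives_closed X) => _ _; rewrite /closed_under /=.
move=> [nil [cons _]] _ _.
elim: vs bs => [|[j x] vs IHvs] [|b bs] vs_L [] //=.
  by move=> _ _; apply: (nil [:: sort_e]).
move: vs_L => /andP[j_L vs_L] [size_bs] sort_bs.
apply: (cons [:: sort_e; code_seq (map code_var vs); code_seq bs; j; x; b]).
split; last by split=> //; apply: IHvs => //; split=> // k; apply: (sort_bs k.+1).
have sorted_b : sort_graph L M (cpair b j).
  by exists b, j; split=> //; apply: (sort_bs 0).
by have := @decides_complete X _ _ (cpair b j) decides_sorts; rewrite asboolT.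
Qed.

Lemma connective_closed tag op (I : atom nat -> Prop) e vs bs f g (x y : bool) :
  closed_under (connective_clauses tag op) I ->
  I (Sat, [:: e; vs; bs; f; x : nat]) -> I (Sat, [:: e; vs; bs; g; y : nat]) ->
  I (Sat, [:: e; vs; bs; cpair tag (cpair f g); op x y : nat]).
Proof.
rewrite /closed_under /= => -[tt [tf [ft [ff _]]]].
by case: x; case: y => If Ig; [move: tt|move: tf|move: ft|move: ff];
  move=> /(_ [:: e; vs; bs; f; g]); apply.
Qed.

(** Both truth values are covered at once, since a negation turns the derivation
    for one value into a derivation for the other. *)
Lemma sat_complete X vs bs (F : formula) :
  quantifier_free F -> is_formula L F -> {subset free_vars F <= vs} ->
  size vs <= size bs ->
  derives X (Sat, [:: rel_e; code_seq (map code_var vs); code_seq bs;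
    code_formula F; `[< sat M (fun v => nth 0 bs (index v vs)) F >] : nat]).
Proof.
case/closed_clauses: (derives_closed X) => _ _.
case/for_all_cat=> + /for_all_cat[and_rule /for_all_cat[or_rule imp_rule]] _ _.
move=> /= [_ [_ [eq1 [eq0 [rel [bot [not0 [not1 _]]]]]]]] + + + le_size.
pose vsc := code_seq (map code_var vs); pose bsc := code_seq bs.
have val v : v \in vs ->
    derives X (Val, [:: vsc; bsc; code_var v; nth 0 bs (index v vs)]).
  move=> v_vs; rewrite -(index_map code_var_inj); apply: val_complete.
    exact: map_f.
  by rewrite size_map.
elim: F => [v w|i us||F IHF|F IHF G IHG|F IHF G IHG|F IHF G IHG|v F _|v F _] //=.
- move=> _ _ sub_vs; have v_vs : v \in vs by apply: sub_vs; rewrite mem_head.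
  have w_vs : w \in vs by apply: sub_vs; rewrite !inE eqxx orbT.
  case: asboolP => [eq_vw|neq_vw].
    apply: (eq1 [:: rel_e; vsc; bsc; code_var v; code_var w; nth 0 bs (index v vs)]).
    by split; [exact: val|split=> //=; rewrite eq_vw; apply: val].
  apply: (eq0 [:: rel_e; vsc; bsc; code_var v; code_var w;
    nth 0 bs (index v vs); nth 0 bs (index w vs)]).
  by split; [exact: val|split; [exact: val|split=> //; apply: neq_complete]].
- move=> _ /andP[i_L _] sub_vs.
  pose s v := nth 0 bs (index v vs); set t := nat_of_bool _.
  apply: (rel [:: rel_e; vsc; bsc; i; code_seq (map code_var us);
    code_seq (map s us); t]).
  split.
    have -> : map s us =
        [seq nth 0 bs (index w (map code_var vs)) | w <- map code_var us].
      by rewrite -map_comp; apply: eq_map => v; rewrite /s /= (index_map code_var_inj).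
    apply: vals_complete; last by rewrite size_map.
    by move=> _ /mapP[v v_us ->]; apply/map_f/sub_vs.
  split=> //; have -> : t = `[< rel_graph L M (cpair (code_seq (map s us)) i) >].
    congr nat_of_bool; apply/asbool_equiv_eq; split=> [rel_us|[b [j]]].
      by exists (map s us), i.
    by case=> /cpair_inj[/code_seq_inj-> ->].
  exact: decides_complete.
- by move=> _ _ _; rewrite asboolF//; apply: (bot [:: rel_e; vsc; bsc]).
- move=> F_qf F_L sub_vs; have := IHF F_qf F_L sub_vs.
  case: asboolP => [F_true|F_false] dF.
    rewrite asboolF; last by apply.
    by apply: (not0 [:: rel_e; vsc; bsc; code_formula F]); split.
  rewrite asboolT//.
  by apply: (not1 [:: rel_e; vsc; bsc; code_formula F]); split.
- move=> /andP[F_qf G_qf] /andP[F_L G_L] sub_vs; rewrite asbool_and.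
  apply: connective_closed and_rule _ _.
    by apply: IHF => // v v_F; apply: sub_vs; rewrite mem_cat v_F.
  by apply: IHG => // v v_G; apply: sub_vs; rewrite mem_cat v_G orbT.
- move=> /andP[F_qf G_qf] /andP[F_L G_L] sub_vs; rewrite asbool_or.
  apply: connective_closed or_rule _ _.
    by apply: IHF => // v v_F; apply: sub_vs; rewrite mem_cat v_F.
  by apply: IHG => // v v_G; apply: sub_vs; rewrite mem_cat v_G orbT.
- move=> /andP[F_qf G_qf] /andP[F_L G_L] sub_vs; rewrite asbool_imply.
  apply: connective_closed imp_rule _ _.
    by apply: IHF => // v v_F; apply: sub_vs; rewrite mem_cat v_F.
  by apply: IHG => // v v_G; apply: sub_vs; rewrite mem_cat v_G orbT.
Qed.

(** Variables that occur in a formula of the language have sorts of the language,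
    which is what lets the sort of a parameter be confirmed by computation. *)
Lemma free_vars_sorts (F : formula) v :
  is_formula L F -> v \in free_vars F -> in_segment (sorts L) v.1.
Proof.
elim: F => [u w|i us||F IHF|F IHF G IHG|F IHF G IHG|F IHF G IHG|u F IHF|u F IHF] //=.
- by case/andP=> /eqP eq_uw; rewrite !inE eq_uw => w_L /orP[] /eqP->; rewrite ?eq_uw.
- move=> /andP[i_L /eqP type_us] v_us.
  by apply: (allP (language_L i_L)); rewrite -type_us map_f.
- by move=> /andP[F_L G_L]; rewrite mem_cat => /orP[/IHF|/IHG]; apply.
- by move=> /andP[F_L G_L]; rewrite mem_cat => /orP[/IHF|/IHG]; apply.
- by move=> /andP[F_L G_L]; rewrite mem_cat => /orP[/IHF|/IHG]; apply.
- by move=> /andP[_ F_L]; rewrite mem_filter => /andP[_ /IHF]; apply.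
- by move=> /andP[_ F_L]; rewrite mem_filter => /andP[_ /IHF]; apply.
Qed.

Lemma pformula_sorts (F : pformula) : is_qf_pformula L F ->
  all (in_segment (sorts L)) (var_type (xvars F)) /\
  all (in_segment (sorts L)) (var_type (yvars F)).
Proof.
case=> _ F_L _ vars_F; split; apply/allP => _ /mapP[v v_F ->];
  by apply: (free_vars_sorts F_L); rewrite -vars_F mem_cat v_F ?orbT.
Qed.

Lemma structure_complete X :
  derives X (Eval, [:: c; 1; cpair dom_e (cpair sort_e rel_e)]).
Proof. by case: eval_c => P <-; apply: program_complete. Qed.

Lemma sol_complete X (F : pformula) a d : is_qf_pformula L F ->
  has_type M (var_type (xvars F)) a -> solutions M F a d ->
  derives X (Sol, [:: c; code_pformula F; code_seq a; code_seq d]).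
Proof.
case/closed_clauses: (derives_closed X) => _ _ _ _; rewrite /closed_under /=.
move=> [sol _] F_ok typed_a [typed_d sat_F].
pose codes_of vs := code_seq (map code_var vs).
apply: (sol [:: c; 0; 0; 0; 0; code_formula (fml F); codes_of (xvars F);
  codes_of (yvars F); code_seq a; code_seq d; dom_e; sort_e; rel_e;
  codes_of (xvars F ++ yvars F); code_seq (a ++ d)]).
split; first exact: structure_complete.
split; first exact: typed_complete (pformula_sorts F_ok).2 typed_d.
split; first by rewrite /codes_of map_cat; apply: app_complete.
split; first exact: app_complete.
split=> //; case: F_ok => F_qf F_L _ vars_F.
have := @sat_complete X (xvars F ++ yvars F) (a ++ d) (fml F) F_qf F_L.
rewrite asboolT//; apply; first by move=> v; rewrite vars_F.
by rewrite !size_cat typed_a.1 typed_d.1 !size_map.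
Qed.

Lemma div2_complete X u : derives X (Div2, [:: u; u./2; odd u : nat]).
Proof.
case/closed_clauses: (derives_closed X) => _ _ _; rewrite /closed_under /=.
move=> [zero [one [step _]]] _.
elim/ltn_ind: u => -[|[|u]] IHu; [exact: (zero [::])|exact: (one [::])|].
by rewrite /= negbK; apply: (step [:: u; u./2; odd u : nat]); split=> //; apply: IHu.
Qed.

Lemma bit_complete X u i : canonical_set u i -> derives X (Bit, [:: u; i]).
Proof.
case/closed_clauses: (derives_closed X) => _ _ _; rewrite /closed_under /=.
move=> [_ [_ [_ [bit0 [bitS _]]]]] _.
elim: i u => [|i IHi] u u_i.
  apply: (bit0 [:: u; u./2]); split=> //.
  by have := @div2_complete X u; rewrite canonical_set0 in u_i; rewrite u_i.
apply: (bitS [:: u; u./2; i; 0; odd u : nat]); split; first exact: div2_complete.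
by split=> //; apply: IHi; rewrite -canonical_setS.
Qed.

Lemma in_dom_complete X u k : (forall i, canonical_set u i -> dom M (k + i)) ->
  derives X (InDom, [:: dom_e; u; k]).
Proof.
case/closed_clauses: (derives_closed X) => _ _ _; rewrite /closed_under /=.
move=> [_ [_ [_ [_ [_ [empty [even [odd_rule _]]]]]]]] _.
elim/ltn_ind: u k => -[|u] IHu k in_dom; first exact: (empty [:: 0; 0; 0; dom_e; k]).
have half_rule : derives X (InDom, [:: dom_e; u.+1./2; k.+1]).
  apply: IHu => [|i u_i]; first by rewrite -divn2 ltn_Pdiv.
  by rewrite addSnnS; apply: in_dom; rewrite canonical_setS.
have := @div2_complete X u.+1; case: (boolP (odd u.+1)) => odd_u half_u; last first.
  by apply: (even [:: u.+1; u.+1./2; 0; dom_e; k]); split.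
apply: (odd_rule [:: u.+1; u.+1./2; 0; dom_e; k]); split=> //; split=> //.
have := @decides_complete X _ _ k decides_dom; rewrite asboolT//.
by rewrite -[k]addn0; apply: in_dom; rewrite canonical_set0.
Qed.

Lemma acl_complete u b :
  acl M Phi (canonical_set u) b ->
  derives (ACL0 L M) (Acl, [:: c; p; u; code_seq [:: b]]).
Proof.
set X := ACL0 L M.
case/closed_clauses: (derives_closed X) => _ _ _ _; rewrite /closed_under /=.
move=> [_ [nil [base [step _]]]] [m _].
(* An entry can only be added in front of a sequence that is already derived, so
   the induction on the stage has to allow an arbitrary sequence behind it. *)
have acl_nil : derives X (Acl, [:: c; p; u; 0]) by apply: (nil [:: c; p; u]).
suff acl_cons bs : derives X (Acl, [:: c; p; u; code_seq bs]) ->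
    iter m (cl1 M Phi) (canonical_set u) b ->
    derives X (Acl, [:: c; p; u; code_seq (b :: bs)]) by exact: (acl_cons [::]).
elim: m b bs => [|m IHm] b bs acl_bs /=.
  move=> u_b; apply: (base [:: c; p; u; b; code_seq bs]).
  by split; first exact: bit_complete.
case=> [/IHm|[F [a [d [Phi_F [typed_a acl_a] fin_F sol_d b_d]]]]]; first exact.
have F_ok := Phi_qf Phi_F.
apply: (step [:: c; p; u; b; code_seq bs; code_formula (fml F);
  code_seq (map code_var (xvars F)); code_seq (map code_var (yvars F));
  code_seq a; code_seq d; dom_e; sort_e; rel_e]).
split.
  have := @decides_complete X _ _ (code_pformula F) decides_Phi.
  by rewrite asboolT//; exists F.
split; first exact: structure_complete.
split; first exact: typed_complete (pformula_sorts F_ok).1 typed_a.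
split.
  elim: {typed_a fin_F sol_d} a acl_a => [|x a IHa] acl_a //.
  apply: IHm; last by apply: acl_a; rewrite mem_head.
  by apply: IHa => e a_e; apply: acl_a; rewrite inE a_e orbT.
split; first by apply: derivable_hyp; exists F, a.
split; first exact: sol_complete.
by split; first exact: mem_complete.
Qed.

Theorem goal_complete n :
  acl_set M Phi n -> derives (ACL0 L M) (Goal, [:: c; p; n]).
Proof.
set X := ACL0 L M.
case/closed_clauses: (derives_closed X) => _ _ _ _; rewrite /closed_under /=.
move=> [_ [_ [_ [_ [goal _]]]]] [b [u [-> in_dom acl_b]]].
apply: (goal [:: c; p; u; b; 0; 0; 0; 0; 0; 0; dom_e; sort_e; rel_e]).
split; first exact: structure_complete.
split; first by apply: in_dom_complete => i; rewrite add0n; apply: in_dom.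
by split=> //; apply: acl_complete.
Qed.

Definition sol_atom (y b : nat) : atom nat :=
  (Sol, [:: c; pfst y; psnd y; b]).

(** All solutions are derived, without hypotheses; so a bound on the codes of the
    derived ones leaves only finitely many. *)
Lemma finitely_solvable_bounded y N :
  (forall b, derives set0 (sol_atom y b) -> b <= N) -> finitely_solvable y.
Proof.
move=> le_N F a F_ok typed_a eq_y.
apply: (@sub_finite_set _ _ (decode @` `I_N.+1)); last exact/finite_image/finite_II.
move=> d sol_d; exists (code_seq d); last exact: code_seqK.
apply: le_N; rewrite /sol_atom eq_y pfstK psndK.
exact: sol_complete.
Qed.

(** By soundness only true solutions are derived, and their codes are bounded
    when there are finitely many. *)
Lemma ACL0_bounded y : ACL0 L M y ->
  exists N, forall b, derives set0 (sol_atom y b) -> b <= N.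
Proof.
case=> F [a [-> F_ok _ /finite_seqP[ds sols]]].
exists (\max_(d <- ds) code_seq d) => b /derives_sound sol_b.
have : solutions M F a (decode b).
  rewrite -[a]code_seqK; move: sol_b.
  by rewrite /sol_atom pfstK psndK => /(_ (fun y => False_ind _)); apply.
rewrite sols /= => b_ds; rewrite -[leqLHS]decodeK.
exact: leq_bigmax_seq.
Qed.

Lemma ACL0_finitely_solvable : ACL0 L M `<=` finitely_solvable.
Proof. by move=> y /ACL0_bounded[N]; apply: finitely_solvable_bounded. Qed.

End Meaning.

(** One number bounds the solutions of all hypotheses of a proof, so that it can
    be guessed along with the proof. *)
Lemma common_bound (s : seq nat) (Q : nat -> nat -> Prop) :
  (forall x, exists N, forall b, Q x b -> b <= N) ->
  exists N, forall x, x \in s -> forall b, Q x b -> b <= N.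
Proof.
move=> bounded; elim: s => [|x s [N le_N]]; first by exists 0.
have [K le_K] := bounded x; exists (maxn K N) => y; rewrite inE.
by case/predU1P=> [->|y_s] b Qb; rewrite leq_max ?(le_K _ Qb)// (le_N _ y_s _ Qb) orbT.
Qed.

(** * The two indices *)

Lemma computable_code_atom q (Fs : seq (set nat -> nat -> nat)) :
  for_all computable Fs ->
  computable (fun X n => code_atom (q, [seq F X n | F <- Fs])).
Proof.
move=> cFs; apply: computable_pair; first exact: computable_const.
elim: Fs cFs => [|F Fs IHFs] /=; first by move=> _; apply: computable_const.
by case=> cF /IHFs cFs; apply/computable_succ/computable_pair.
Qed.

(** The parameters of a decidable test go into the index, uniformly in the oracle
    that the test consults. *)
Lemma uniform_index (B : set nat -> nat -> bool) :
  computable (fun X n => B X n) ->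
  exists2 h : nat -> nat -> nat, computable2 h &
    forall X c p, decides X (h c p) [set n | B X (cpair n (cpair c p))].
Proof.
case=> P run_P; have [h ch hP] := parameter_theorem P; exists h => // X c p n.
have := hP X c p n _ (run_P X _) => /=.
by case: (B X _) => run_h; split=> // /(_ isT).
Qed.

Definition goal_in (s n c p : nat) : bool :=
  code_atom (Goal, [:: c; p; n]) \in [seq pfst it | it <- decode s].

Definition proves_goal (X : set nat) (n s c p : nat) : bool :=
  [&& is_proof clauses (decode s), hyps_hold X (decode s) & goal_in s n c p].

(** Such a [k] shows that [N] does not bound the solutions of some hypothesis of
    the proof [s]. The oracle restricts the hypotheses of the inner proof; it is
    empty where this is used. *)
Definition refutes (X : set nat) (k s N c : nat) : bool :=
  let y := pfst k in let b := pfst (psnd k) in let t := psnd (psnd k) in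
  [&& code_atom (Hyp, [:: y]) \in [seq pfst it | it <- decode s],
      is_proof clauses (decode t), hyps_hold X (decode t),
      code_atom (sol_atom c y b) \in [seq pfst it | it <- decode t]
    & N < b].

Lemma computable_proves_goal : computable (fun X m =>
  proves_goal X (pfst (pfst m)) (psnd (pfst m)) (pfst (psnd m)) (psnd (psnd m))).
Proof.
have cn := computable_pfst computable_id; have cz := computable_psnd computable_id.
have cs := computable_psnd cn.
apply: computable_andb; first exact: computable_is_proof.
apply: computable_andb; first exact: computable_hyps_hold.
apply: computable_mem cs.
apply: (@computable_code_atom Goal [:: _; _; _]).
split; first exact: computable_pfst cz.
split; first exact: computable_psnd cz.
by split=> //; apply: computable_pfst cn.
Qed.

Lemma computable_bounded_proof : computable (fun X m =>
  let n := pfst (pfst m) in let j := pfst (psnd (pfst m)) in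
  let k := psnd (psnd (pfst m)) in
  let c := pfst (psnd m) in let p := psnd (psnd m) in
  [&& is_proof clauses (decode (pfst j)), goal_in (pfst j) n c p
    & ~~ refutes X k (pfst j) (psnd j) c]).
Proof.
have cjk := computable_psnd (computable_pfst computable_id).
have cj := computable_pfst cjk; have ck := computable_psnd cjk.
have cz := computable_psnd computable_id; have cc := computable_pfst cz.
have cs := computable_pfst cj; have cy := computable_pfst ck.
have cb := computable_pfst (computable_psnd ck).
have ct := computable_psnd (computable_psnd ck).
apply: computable_andb; first exact: computable_is_proof.
apply: computable_andb.
  apply: computable_mem cs; apply: (@computable_code_atom Goal [:: _; _; _]).
  split=> //; split; first exact: computable_psnd cz.
  by split=> //; apply/computable_pfst/computable_pfst/computable_id.
apply: computable_negb; apply: computable_andb.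
  by apply: computable_mem cs; apply: (@computable_code_atom Hyp [:: _]).
apply: computable_andb; first exact: computable_is_proof.
apply: computable_andb; first exact: computable_hyps_hold.
apply: computable_andb.
  apply: computable_mem ct; apply: (@computable_code_atom Sol [:: _; _; _; _]).
  split=> //; split; first exact: computable_pfst cy.
  by split; first exact: computable_psnd cy.
exact/computable_leq/cb/computable_succ/computable_psnd.
Qed.

Lemma heads_not_hyp : all (fun cl => symbol_code cl.1.1 != 0) clauses.
Proof. by []. Qed.

Theorem proposition3p3 :
  exists f g : nat -> nat -> nat,
    [/\ computable2 f, computable2 g &
      forall (c : nat) (L : language) (M : structure), codes c L M ->
      forall (Phi : set pformula) (p : nat),
        (forall F, Phi F -> is_qf_pformula L F) ->
        decides set0 p [set code_pformula F | F in Phi] ->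
        Sigma1_index (ACL0 L M) (f c p) (acl_set M Phi) /\
        Sigma2_index set0 (g c p) (acl_set M Phi)].
Proof.
have [f cf decides_f] := uniform_index computable_proves_goal.
have [g cg decides_g] := uniform_index computable_bounded_proof.
exists f, g; split=> // c L M.
case=> [l [m [_ eval_c [L_ok _] [_ [d [s [r [eq_m dd ds dr]]]]]]]] Phi p Phi_qf dp.
rewrite eq_m in eval_c.
have sound X n : X `<=` finitely_solvable L M ->
    derives X (Goal, [:: c; p; n]) -> acl_set M Phi n.
  by move=> fin_X /(derives_sound eval_c dd ds dr Phi_qf dp fin_X); apply.
have complete n := goal_complete L_ok eval_c dd ds dr Phi_qf dp n.
split; [eexists; first exact: decides_f|eexists; first exact: decides_g] => n; split.
- move=> /complete/(proof_complete heads_not_hyp)[t [t_ok t_hyps t_goal]].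
  exists (code_seq t); rewrite /= !(pfstK, psndK) /proves_goal /goal_in code_seqK.
  by rewrite t_ok t_hyps.
- case=> j /=; rewrite !(pfstK, psndK) => /and3P[t_ok t_hyps t_goal].
  apply: (sound (ACL0 L M)); last exact: proof_sound t_ok t_hyps t_goal.
  exact: (ACL0_finitely_solvable L_ok eval_c dd ds dr Phi_qf dp).
- move=> /complete/(proof_complete heads_not_hyp)[t [t_ok t_hyps t_goal]].
  pose Q x b := exists y, [/\ ACL0 L M y, x = code_atom (Hyp, [:: y])
                            & derives set0 (sol_atom c y b)].
  have [|N le_N] := @common_bound (map pfst t) Q.
    move=> x; have [[y [y_fin ->]]|no_y] := EM (exists y,
        ACL0 L M y /\ x = code_atom (Hyp, [:: y])); last first.
      by exists 0 => b [y [y_fin eq_x _]]; case: no_y; exists y.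
    have [N le_N] := ACL0_bounded eval_c dd ds dr Phi_qf dp y_fin.
    by exists N => b [z [_ /code_atom_inj[<-]]]; apply: le_N.
  exists (cpair (code_seq t) N) => k /=; rewrite !(pfstK, psndK) /goal_in code_seqK.
  rewrite t_ok t_goal; apply/negP => /and5P[]; rewrite code_seqK.
  set y := pfst k => hyp_y u_ok u_hyps u_sol; apply/negP; rewrite -leqNgt.
  apply: (le_N _ hyp_y); exists y; split=> //.
    exact: (hyps_holdP heads_not_hyp t_ok t_hyps hyp_y).
  exact: (proof_sound u_ok u_hyps u_sol).
- case=> j ok_j; pose t := decode (pfst j).
  have {}ok_j k : [&& is_proof clauses t, goal_in (pfst j) n c p
      & ~~ refutes set0 k (pfst j) (psnd j) c].
    by have := ok_j k; rewrite /= !(pfstK, psndK).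
  have /and3P[t_ok t_goal _] := ok_j 0.
  have := proof_sound t_ok (hyps_hold_self t) t_goal.
  apply: sound => y /= hyp_y.
  apply: (finitely_solvable_bounded L_ok eval_c ds dr (N := psnd j)) => b.
  move=> /(proof_complete heads_not_hyp)[u [u_ok u_hyps u_sol]].
  have /and3P[_ _] := ok_j (cpair y (cpair b (code_seq u))).
  rewrite /refutes !(pfstK, psndK) code_seqK hyp_y u_ok u_hyps u_sol /=.
  by rewrite -leqNgt.
Qed.
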